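(* For all integers $q,k\ge2$ there exists $\alpha_0\in(0,1/k)$ such that for every $\alpha\in(0,\alpha_0]$, every $T\in\mathbb{N}$ and every $\delta\in(0,1)$ there exist $\tau\in(0,1)$ and $n_0$ such that for every $n\ge n_0$, every protocol for the $\textsf{IFRMD}$ game with parameters $q,k,n,T,\alpha$ that achieves advantage greater than $\delta$ has some player sending a message of at least $\tau n$ bits.
   Context: A $k$-hypermatching of size $m$ on $[n]$ is a list $e_1,\dots,e_m$ of pairwise disjoint ordered $k$-tuples of distinct elements of $[n]$, $e_i=((e_i)_1,\dots,(e_i)_k)$. Given centers $\mathbf{c}=(c_1,\dots,c_m)$ with $c_i=(e_i)_k$, the $\mathbf{c}$-centered folded encoding is $A_{\mathbf{c}}\in\mathbb{Z}_q^{(k-1)m\times n}$ with, for $i\in[m]$ and $\ell\in[k-1]$, row $(k-1)(i-1)+\ell$ having entry $1$ in column $(e_i)_\ell$, entry $-1$ in column $c_i$, and $0$ elsewhere. Assume $\alpha n$ is an integer. In the $\textsf{IFRMD}$ game there are $T$ players and a hidden uniformly random $\mathbf{x}^*\in\mathbb{Z}_q^n$. Player $t$ receives $A_{t,\mathbf{c}_t}$, the folded encoding of an independent uniformly random $k$-hypermatching $M_t$ of size $\alpha n$ (with centers the last vertices of its edges), and a vector $\mathbf{w}_t\in\mathbb{Z}_q^{(k-1)\alpha n}$, which equals $A_{t,\mathbf{c}_t}\mathbf{x}^*$ in the YES case and is uniformly random (independent of everything) in the NO case. Communication is one-way: player $t$ sends a message to player $t+1$ depending on its input and the message it received; player $T$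 outputs Yes or No. The advantage is $|\Pr_{\text{YES}}[\text{output Yes}]-\Pr_{\text{NO}}[\text{output Yes}]|$. *)

(* Defs.v *)
From HB Require Import structures.
From mathcomp Require Import all_boot all_order all_algebra.
From mathcomp Require Import reals.
Set Implicit Arguments. Unset Strict Implicit. Unset Printing Implicit Defensive.
Import Order.TTheory GRing.Theory Num.Theory.
Local Open Scope ring_scope.

Section IFRMD.
Variables (q k n m T : nat).

(* A k-hypermatching of size m on [n] (vertices 'I_n, 0-indexed):
   edge i (i : 'I_m) is the ordered k-tuple (M (i,0), ..., M (i,k-1));
   "pairwise disjoint edges of distinct elements" = M injective. *)
Definition hypermatching := {ffun 'I_m * 'I_k -> 'I_n}.
Definition is_hypermatching (M : hypermatching) : bool := injectiveb M.

Definition is_center (M : hypermatching) (i : 'I_m) (j : 'I_n) : bool :=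
  [exists c : 'I_k, (val c == k.-1) && (M (i, c) == j)].

(* Row r of the folded encoding corresponds to the pair (i, l) with
   r = i * (k-1) + l  (this is (k-1)(i-1)+l in the paper's 1-indexing);
   enum_val (cast_ord (esym (@mxvec_cast m k.-1)) r) is the inverse of mxvec_index. *)
Definition row_pair (r : 'I_(m * k.-1)) : 'I_m * 'I_k.-1 :=
  enum_val (cast_ord (esym (@mxvec_cast m k.-1)) r).

Definition folded_enc (M : hypermatching) : 'M['Z_q]_(m * k.-1, n) :=
  \matrix_(r, j)
    let p := row_pair r in
    (if M (p.1, widen_ord (leq_pred k) p.2) == j then 1 else 0)
    - (if is_center M p.1 j then 1 else 0).

Definition mx_t := 'M['Z_q]_(m * k.-1, n).
Definition vec_t := 'cV['Z_q]_(m * k.-1).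

(* A deterministic one-way protocol: player t+1 (t = 0, ..., T-2) sends
   send t A w msg_in (a bit string); player T (the last) outputs
   decide A w msg_in (true = Yes).  Player 1 receives the empty message. *)
Record protocol := Protocol {
  send : nat -> mx_t -> vec_t -> seq bool -> seq bool;
  decide : mx_t -> vec_t -> seq bool -> bool }.

Definition nth_input (X : Type) (d : X) (f : 'I_T -> X) (t : nat) : X :=
  match insub t with Some i => f i | None => d end.

Fixpoint received (P : protocol) (A : nat -> mx_t) (w : nat -> vec_t)
    (t : nat) : seq bool :=
  match t with
  | 0 => [::]
  | t'.+1 => send P t' (A t') (w t') (received P A w t')
  end.

Definition run_A (Ms : {ffun 'I_T -> hypermatching}) : nat -> mx_t :=
  nth_input 0 (fun t => folded_enc (Ms t)).

Definition output (P : protocol) (Ms : {ffun 'I_T -> hypermatching})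
    (ws : 'I_T -> vec_t) : bool :=
  let A := run_A Ms in let w := nth_input 0 ws in
  decide P (A T.-1) (w T.-1) (received P A w T.-1).

Definition valid_profile (Ms : {ffun 'I_T -> hypermatching}) : bool :=
  [forall t, is_hypermatching (Ms t)].

Variable R : realType.

Definition unif_prob (X : finType) (S : {pred X}) (E : {pred X}) : R :=
  #|[predI S & E]|%:R / #|S|%:R.

Definition prob_yes (P : protocol) : R :=
  unif_prob (X := ('cV['Z_q]_n * {ffun 'I_T -> hypermatching})%type)
    (fun xM => valid_profile xM.2)
    (fun xM => output P xM.2 (fun t => folded_enc (xM.2 t) *m xM.1)).

(* NO case: M_t as before, w_t independent uniform in Z_q^{(k-1)m}
   (x* is independent of everything and unused, hence omitted). *)
Definition prob_no (P : protocol) : R :=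
  unif_prob (X := ({ffun 'I_T -> hypermatching} * {ffun 'I_T -> vec_t})%type)
    (fun Mw => valid_profile Mw.1)
    (fun Mw => output P Mw.1 Mw.2).

Definition advantage (P : protocol) : R := `|prob_yes P - prob_no P|.

Definition some_long_message (P : protocol) (tau : R) : Prop :=
  exists (Ms : {ffun 'I_T -> hypermatching}) (ws : {ffun 'I_T -> vec_t})
         (t : nat),
    [/\ valid_profile Ms, (t < T.-1)%N &
        tau * n%:R <= (size (received P (run_A Ms) (nth_input 0 ws) t.+1))%:R].

End IFRMD.

(* Main.v *)
Require Import Defs.
From HB Require Import structures.
From mathcomp Require Import all_boot all_order all_algebra.
From mathcomp Require Import perm cyclic separable cyclotomic.
From mathcomp Require Import ring lra zify.
From mathcomp Require Import reals.
From mathcomp.real_closed Require Import complex.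
Set Implicit Arguments. Unset Strict Implicit. Unset Printing Implicit Defensive.
Import Order.TTheory GRing.Theory Num.Theory.
Local Open Scope ring_scope.

(* Condition on the matchings M_1, ..., M_t and a message a, and let f_a be the
   indicator of the hidden vectors x producing a.  The advantage is bounded by the
   drift of f_a, in Fourier space, from the constant c_a = Pr[a] of the NO game.

   The potential after t rounds is the average over the matchings of
     sum_a sum_(|u| <= H_t) |f_a^(u) - c_a [u = 0]| beta_t^|u| sqrt(|u|! / n^|u|).
   It is linear in f_a, so no conditioning on likely messages is needed, and its
   u = 0 part is exactly the advantage once t = T.

   One round multiplies f_a by functions g (A_M x), that is, convolves Fourier
   coefficients along s = u + A_M^T v.
   - Frequencies |u| <= H_t: cancellation in u + A_M^T v needs edges of the random
     matching meeting supp u in at least two vertices; r vertices of supp u are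
     covered in this way with probability at most C^r sqrt(r! / n^r), which is what
     the weights are calibrated to.  The remaining edges of v avoid supp u, and
     their Fourier mass on level l, summed over all messages, is at most
     (C sqrt(y m) / l)^l by a high moment and a count of balanced tuples.
   - Frequencies |u| > H_t reach |s| <= H_(t+1) only if the matching covers
     supp (s - u), which has probability at most 2^(-|s - u|); Cauchy-Schwarz then
     beats the number of such s because H_(t+1) is much smaller than H_t.
   Only this last bound constrains alpha, and not through T, since the H_t absorb the
   loss of every round: alpha_0 = 1 / (4 k) works. *)

(** * Roots of unity and the real-valued modulus of complex numbers *)

Local Notation nm := (ComplexField.Normc.normc).

(** As n is nonzero in F, X^n - 1 is separable, so it has n distinct roots; n distinct n-th roots of
    unity always include a primitive one. *)
Lemma prim_root_exists (F : closedFieldType) (n : nat) :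
  (0 < n)%N -> (n%:R != 0 :> F) -> exists z : F, n.-primitive_root z.
Proof.
move=> n0 nF; pose p : {poly F} := 'X^n - 1; have [r Dp] := closed_field_poly_normal p.
rewrite (monicP _) ?monicXnsubC // scale1r in Dp.
have rn1: all n.-unity_root r by apply/allP=> z; rewrite -root_prod_XsubC -Dp.
have sz_r: (n < (size r).+1)%N.
  by rewrite -(size_prod_XsubC r id) -Dp size_XnsubC.
have [|z] := hasP (has_prim_root n0 rn1 _ sz_r); last by exists z.
by rewrite -separable_prod_XsubC -Dp separable_Xn_sub_1.
Qed.

Section NormC.
Variable R : rcfType.
Local Notation C := (R[i]).
Implicit Types z : C.

Lemma nmE z : (nm z)%:C%C = `|z|.
Proof. by rewrite normc_def; case: z. Qed.
Lemma nm_ge0 z : 0 <= nm z.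
Proof. by rewrite -lecR nmE normr_ge0. Qed.
Lemma nmM z z' : nm (z * z') = nm z * nm z'.
Proof. exact: ComplexField.Normc.normcM. Qed.
Lemma nm0 : nm (0 : C) = 0. Proof. exact: ComplexField.Normc.normc0. Qed.
Lemma nm1 : nm (1 : C) = 1. Proof. exact: ComplexField.Normc.normc1. Qed.
Lemma nmX z n : nm (z ^+ n) = nm z ^+ n.
Proof. by elim: n => [|n IH]; rewrite ?expr0 ?nm1 // !exprS nmM IH. Qed.
Lemma nm_real (x : R) : nm (x%:C%C : C) = `|x|.
Proof. by rewrite /= expr0n addr0 sqrtr_sqr. Qed.
Lemma nm_nat n : nm (n%:R : C) = n%:R.
Proof. by rewrite -(rmorph_nat (real_complex R)) nm_real ger0_norm ?ler0n. Qed.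
Lemma nmV z : nm (z^-1) = (nm z)^-1.
Proof. exact: ComplexField.Normc.normcV. Qed.
Lemma nm_conj z : nm (z^*) = nm z.
Proof. by apply: (@complexI R); rewrite !nmE norm_conjC. Qed.
Lemma nmD z z' : nm (z + z') <= nm z + nm z'.
Proof. by rewrite -lecR rmorphD /= !nmE ler_normD. Qed.
Lemma nm_sum (I : finType) (P : pred I) (F : I -> C) :
  nm (\sum_(i | P i) F i) <= \sum_(i | P i) nm (F i).
Proof.
elim/big_rec2: _ => [|i y x _ le]; first by rewrite nm0.
by apply: le_trans (nmD _ _) _; rewrite lerD2l.
Qed.
Lemma nm_prod (I : finType) (P : pred I) (F : I -> C) :
  nm (\prod_(i | P i) F i) = \prod_(i | P i) nm (F i).
Proof. by elim/big_rec2: _ => [|i y x _ <-]; rewrite ?nm1 ?nmM. Qed.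
Lemma sqr_nm z : ((nm z) ^+ 2)%:C%C = z * z^*.
Proof. by rewrite rmorphXn /= nmE normCK. Qed.
(** Used to turn a sum of moduli into a linear expression. The modulus of e is only bounded by 1,
    because e = 0 is taken when z = 0. *)
Lemma exists_phase z : {e : C | nm e <= 1 & e * z = (nm z)%:C%C}.
Proof.
have [->|z0] := eqVneq z 0; first by exists 0; rewrite ?nm0 ?ler01 ?mul0r.
exists ((nm z)%:C%C / z); last by rewrite mulfVK.
rewrite nmM nm_real nmV ger0_norm ?nm_ge0 // divff //.
by apply: contra_neq z0 => /ComplexField.Normc.eq0_normc.
Qed.
End NormC.

(** * Fourier analysis on 'Z_q^I *)

Section Fourier.
Variables (R : rcfType) (q : nat).
Local Notation C := (R[i]).
Local Notation Zq := ('Z_q).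

(** The order [(Zp_trunc q).+2] is the number of elements of ['Z_q], which makes [unity_char] an
    additive character. *)
Definition zeta : C :=
  xchoose (@prim_root_exists C (Zp_trunc q).+2 isT (lt0r_neq0 (ltr0Sn _ _))).
Lemma zetaP : (Zp_trunc q).+2.-primitive_root zeta.
Proof. exact: xchooseP. Qed.

Definition unity_char (a : Zq) : C := zeta ^+ a.
Lemma unity_charD a b : unity_char (a + b) = unity_char a * unity_char b.
Proof. by rewrite /unity_char /= (prim_expr_mod zetaP) exprD. Qed.
Lemma unity_char0 : unity_char 0 = 1. Proof. by []. Qed.
Lemma unity_char_eq1 a : (unity_char a == 1) = (a == 0).
Proof.
rewrite /unity_char -(expr0 zeta) (eq_prim_root_expr zetaP) mod0n modn_small ?ltn_ord //.
Qed.
Lemma nm_unity_char a : nm (unity_char a) = 1.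
Proof.
apply/eqP; rewrite -(@pexpr_eq1 _ _ (Zp_trunc q).+2) ?nm_ge0 // -nmX -exprM mulnC exprM.
by rewrite (prim_expr_order zetaP) expr1n nm1.
Qed.
Lemma unity_charN a : unity_char (- a) = (unity_char a)^*.
Proof.
have e0 : unity_char a != 0 by apply: contra_eq_neq (nm_unity_char a) => ->; rewrite nm0 eq_sym oner_eq0.
apply: (mulfI e0); rewrite -unity_charD subrr unity_char0.
by rewrite -sqr_nm nm_unity_char expr1n.
Qed.
Lemma unity_char_sum (J : finType) (P : pred J) (F : J -> Zq) :
  unity_char (\sum_(j | P j) F j) = \prod_(j | P j) unity_char (F j).
Proof. by elim/big_rec2: _ => [|j x y _ <-]; rewrite ?unity_char0 ?unity_charD. Qed.

Variable I : finType.
Local Notation V := {ffun I -> Zq}.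
Implicit Types (s t x y : V) (f g : V -> C).

Definition dot s x : Zq := \sum_i s i * x i.
Lemma dotC s x : dot s x = dot x s.
Proof. by apply: eq_bigr => i _; rewrite mulrC. Qed.
Lemma dotDl s t x : dot (s + t) x = dot s x + dot t x.
Proof. by rewrite -big_split; apply: eq_bigr => i _ /=; rewrite ffunE mulrDl. Qed.
Lemma dotNl s x : dot (- s) x = - dot s x.
Proof. by rewrite -sumrN; apply: eq_bigr => i _; rewrite ffunE mulNr. Qed.
Lemma dot0l x : dot 0 x = 0.
Proof. by rewrite /dot big1 // => i _; rewrite ffunE mul0r. Qed.
Lemma dot_delta s j : dot s [ffun i => (i == j)%:R] = s j.
Proof.
rewrite /dot (bigD1 j) //= ffunE eqxx mulr1 big1 ?addr0 // => i /negPf ij.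
by rewrite ffunE ij mulr0.
Qed.

Definition chi s x : C := unity_char (dot s x).
Lemma chiC s x : chi s x = chi x s. Proof. by rewrite /chi dotC. Qed.
Lemma chiDl s t x : chi (s + t) x = chi s x * chi t x.
Proof. by rewrite /chi dotDl unity_charD. Qed.
Lemma chiDr s x y : chi s (x + y) = chi s x * chi s y.
Proof. by rewrite chiC chiDl !(chiC s). Qed.
Lemma chiN s x : chi (- s) x = (chi s x)^*.
Proof. by rewrite /chi dotNl unity_charN. Qed.
Lemma chi0 x : chi 0 x = 1. Proof. by rewrite /chi dot0l unity_char0. Qed.
Lemma nm_chi s x : nm (chi s x) = 1. Proof. exact: nm_unity_char. Qed.

Definition cV : C := #|{: V}|%:R.
Lemma cV_neq0 : cV != 0.
Proof. by rewrite /cV pnatr_eq0 -lt0n; apply/card_gt0P; exists 0. Qed.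

(** Shifting x by the unit vector at a coordinate where s is nonzero multiplies the sum by a number
    other than 1, so the sum vanishes. *)
Lemma sum_chi s : \sum_x chi s x = if s == 0 then cV else 0.
Proof.
case: eqVneq => [->|s0].
  by rewrite (eq_bigr (fun=> 1)) ?sumr_const // => x _; rewrite chi0.
have [j sj] : exists j, s j != 0.
  apply/existsP; apply: contraNT s0; rewrite negb_exists => /forallP s0.
  by apply/eqP/ffunP => i; rewrite ffunE; apply/eqP; have := s0 i; rewrite negbK.
pose d : V := [ffun i => (i == j)%:R].
have : \sum_x chi s x = chi s d * \sum_x chi s x.
  rewrite mulr_sumr (reindex_inj (addrI d)).
  by apply: eq_bigr => x _; rewrite chiDr.
move/eqP; rewrite -subr_eq0 -{1}(mul1r (\sum_x _)) -mulrBl mulf_eq0 => /orP[|/eqP //].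
by rewrite subr_eq0 eq_sym /chi dot_delta unity_char_eq1 (negPf sj).
Qed.

(** Normalised as an average, so that the coefficient at 0 of an indicator is a probability. *)
Definition fc f s : C := cV^-1 * \sum_x f x * chi (- s) x.

Lemma sum_chi_mul x y :
  \sum_(s : V) chi (- s) y * chi s x = if x == y then cV else 0.
Proof.
rewrite -subr_eq0 -sum_chi; apply: eq_bigr => s _.
by rewrite [RHS]chiC chiDr chiN [chi s (- y)]chiC chiN (chiC y) mulrC.
Qed.

Lemma fc_inv f x : f x = \sum_(s : V) fc f s * chi s x.
Proof.
under eq_bigr do rewrite /fc -mulrA mulr_suml.
rewrite -mulr_sumr exchange_big /=.
have E y : \sum_(s : V) f y * chi (- s) y * chi s x = f y * (if x == y then cV else 0).
  by rewrite -sum_chi_mul mulr_sumr; apply: eq_bigr => s _; rewrite mulrA.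
under eq_bigr do rewrite E.
rewrite (bigD1 x) //= eqxx big1 ?addr0 => [|y /negPf]; last by rewrite eq_sym => ->; rewrite mulr0.
by rewrite mulrCA mulVf ?cV_neq0 // mulr1.
Qed.

Lemma fc_sum (J : finType) (P : pred J) (F : J -> V -> C) s :
  fc (fun x => \sum_(j | P j) F j x) s = \sum_(j | P j) fc (F j) s.
Proof.
rewrite /fc -mulr_sumr exchange_big /=; congr (_ * _).
by apply: eq_bigr => x _; rewrite mulr_suml.
Qed.
Lemma fcZ c f s : fc (fun x => c * f x) s = c * fc f s.
Proof.
rewrite /fc [RHS]mulrCA; congr (_ * _); rewrite mulr_sumr.
by apply: eq_bigr => x _; rewrite mulrA.
Qed.
Lemma eq_fc f g : f =1 g -> fc f =1 fc g.
Proof. by move=> fg s; rewrite /fc; congr (_ * _); apply: eq_bigr => x _; rewrite fg. Qed.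
Lemma fc_chi_mul f t s : fc (fun x => f x * chi t x) s = fc f (s - t).
Proof.
rewrite /fc; congr (_ * _); apply: eq_bigr => x _.
by rewrite opprB addrC chiDl mulrAC mulrA.
Qed.
Lemma fc_const c s : fc (fun=> c) s = if s == 0 then c else 0.
Proof.
rewrite /fc -mulr_sumr sum_chi oppr_eq0; case: ifP => _; last by rewrite !mulr0.
by rewrite mulrCA mulVf ?cV_neq0 ?mulr1.
Qed.

Lemma parseval f :
  \sum_s nm (fc f s) ^+ 2 = (#|{: V}|%:R)^-1 * \sum_x nm (f x) ^+ 2.
Proof.
apply: (@complexI R); rewrite rmorphM fmorphV rmorph_nat !rmorph_sum /= -/cV.
under eq_bigr => s _ do rewrite sqr_nm {2}/fc rmorphM fmorphV rmorph_nat rmorph_sum mulrCA mulr_sumr.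
rewrite -mulr_sumr; congr (_ * _); rewrite exchange_big /=.
apply: eq_bigr => x _; rewrite sqr_nm [X in _ = X * _]fc_inv mulr_suml; apply: eq_bigr => s _.
by rewrite rmorphM /= chiN conjCK mulrA mulrAC.
Qed.

Lemma sum_nm_fc_le1 f : (forall x, nm (f x) <= 1) -> \sum_s nm (fc f s) ^+ 2 <= 1.
Proof.
move=> f1; rewrite parseval ler_pdivrMl ?mulr1; last first.
  by rewrite ltr0n; apply/card_gt0P; exists 0.
rewrite -sum1_card natr_sum; apply: ler_sum => x _.
by rewrite exprn_ile1 ?nm_ge0.
Qed.
End Fourier.

(** * Counting injections *)

Section Counting.
Local Open Scope nat_scope.

(** Pads a set to a prescribed size, so that union bounds can run over sets of one fixed size. *)
Lemma superset_card (T : finType) (A : {set T}) r :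
  #|A| <= r <= #|T| -> exists2 B : {set T}, A \subset B & #|B| = r.
Proof.
move=> /andP[]; elim: r => [|r IH].
  by rewrite leqn0 => A0 _; exists A; rewrite ?subxx ?(eqP A0).
rewrite leq_eqVlt => /predU1P[<- _|]; first by exists A.
rewrite ltnS => /IH{}IH rT; have [B AB Br] := IH (ltnW rT).
have /card_gt0P[x xB] : 0 < #|~: B| by rewrite cardsCs setCK Br subn_gt0.
exists (x |: B); first exact: subset_trans AB (subsetUr _ _).
by rewrite cardsU1 -in_setC xB Br.
Qed.

(** x^x is at most the falling factorial (2x)_x = C(2x, x) x!, and C(2x, x) <= 4^x. *)
Lemma leq_expnn_fact x : x ^ x <= 4 ^ x * x`!.
Proof.
have H y : x ^ y <= (x + y) ^_ y.
  elim: y => // y IH; rewrite expnS addnS ffactSS leq_mul //; lia.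
apply: leq_trans (H x) _; rewrite -bin_ffact leq_mul2r; apply/orP; right.
rewrite -[4]/(2 ^ 2) -expnM mul2n addnn -[2]/(1 + 1) expnDn.
have lt : x < x.*2.+1 by lia.
rewrite (bigD1 (Ordinal lt)) //= !exp1n !muln1; exact: leq_addr.
Qed.

Lemma leq_bin_fact n h : 'C(n, h) * h`! <= n ^ h.
Proof.
rewrite bin_ffact; elim: h => // h IH.
by rewrite ffactnSr expnSr leq_mul ?leq_subr.
Qed.

Lemma leq_bin_expn n h : 'C(n, h) * h ^ h <= (4 * n) ^ h.
Proof.
apply: leq_trans (leq_mul (leqnn _) (leq_expnn_fact h)) _.
by rewrite mulnCA expnMn leq_mul2l leq_bin_fact orbT.
Qed.

(** Each of the r factors of the falling factorial is at least n / 2. *)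
Lemma leq_expn_ffact n r : 2 * r <= n -> n ^ r <= 2 ^ r * n ^_ r.
Proof.
move=> rn; have H j : j <= r -> n ^ j <= 2 ^ j * n ^_ j.
  elim: j => // j IH jr; rewrite ffactnSr !expnSr mulnACA leq_mul ?IH //; lia.
exact: H.
Qed.

Lemma leq_card_bigU (X Y : finType) (E : {set X}) (S : {set Y}) (F : Y -> {set X}) :
  (forall x, x \in E -> exists2 y, y \in S & x \in F y) ->
  #|E| <= \sum_(y in S) #|F y|.
Proof.
move=> H; under [leqRHS]eq_bigr do rewrite -sum1_card big_mkcond /=.
rewrite exchange_big /= -sum1_card big_mkcond /=; apply: leq_sum => x _.
case: ifP => // /H[y yS xF]; by rewrite (bigD1 y) //= xF.
Qed.
End Counting.

Section InjCount.
Local Open Scope nat_scope.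
Variables (P T : finType).
Local Notation inj := [set f : {ffun P -> T} | injectiveb f].

Definition constr (cs : seq (P * T)) :=
  [set f in inj | all (fun c => f c.1 == c.2) cs].

(* By symmetry under transpositions of T, prescribing one more value divides the
   number of injections by at least the number of unused values. *)
Lemma card_constr_swap p s t cs :
  s \notin map snd cs -> t \notin map snd cs ->
  #|constr ((p, s) :: cs)| <= #|constr ((p, t) :: cs)|.
Proof.
move=> sc tc; pose h (f : {ffun P -> T}) := [ffun x => tperm s t (f x)].
have hI : injective h.
  by move=> f g /ffunP fg; apply/ffunP => x; have := fg x; rewrite !ffunE => /perm_inj.
rewrite -(card_imset _ hI); apply: subset_leq_card; apply/subsetP => _ /imsetP[f + ->].
rewrite !inE /= => /and3P[/injectiveP fi /eqP fp /allP fc]; apply/and3P; split.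
- by apply/injectiveP => x y; rewrite !ffunE => /perm_inj /fi.
- by rewrite ffunE fp tpermL.
- apply/allP => c no_prob; rewrite ffunE (eqP (fc c no_prob)) tpermD //.
    by apply: contraNneq sc => ->; apply: map_f.
  by apply: contraNneq tc => ->; apply: map_f.
Qed.

Lemma card_constr cs : uniq (map snd cs) ->
  #|constr cs| * #|T| ^_ (size cs) <= #|inj|.
Proof.
elim: cs => [_|[p s] cs IH /= /andP[sc uc]].
  by rewrite ffactn0 muln1; apply: subset_leq_card; apply/subsetP => f; rewrite !inE => /andP[].
rewrite ffactnSr mulnCA mulnC.
apply: leq_trans (IH uc); rewrite leq_mul2r; apply/orP; right.
pose S := [predC map snd cs].
have cS : #|S| = #|T| - size cs.
  by rewrite -(cardC (mem (map snd cs))) (card_uniqP uc) size_map addKn; apply: eq_card.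
rewrite -cS mulnC -sum_nat_const.
apply: (@leq_trans (\sum_(t in S) #|constr ((p, t) :: cs)|)).
  by apply: leq_sum => t tS; rewrite card_constr_swap.
rewrite -sum1_card.
under eq_bigr => t _ do rewrite -sum1_card.
rewrite (partition_big (fun f : {ffun P -> T} => f p) predT) //=.
rewrite big_mkcond /=; apply: leq_sum => t _; case: ifP => // _.
rewrite !sum1_card; apply: subset_leq_card; apply/subsetP => f.
by rewrite !inE /= => /and3P[fi ft fc]; rewrite unfold_in /= inE inE fi fc.
Qed.

(** Union bound over the tuples of preimages of S: each tuple prescribes #|S| distinct values of an
    injection, and [card_constr] bounds the fraction of injections that comply. *)
Lemma card_inj_tuple_bound (S : {set T}) (E : {set {ffun P -> T}})
    (TS : {set #|S|.-tuple P}) :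
  (forall f, f \in E -> injectiveb f) ->
  (forall f, f \in E -> exists2 t, t \in TS & map f t = enum S) ->
  #|E| * #|T| ^_ #|S| <= #|TS| * #|inj|.
Proof.
move=> Ei ET; pose F (t : #|S|.-tuple P) := constr (zip t (enum S)).
have /(leq_card_bigU)H : forall f, f \in E -> exists2 t, t \in TS & f \in F t.
  move=> f fE; have [t tT ft] := ET f fE; exists t => //; rewrite /F !inE Ei //= -ft.
  by apply/allP => c; rewrite -[in X in zip X _](map_id t) zip_map => /mapP[x _ ->] /=.
apply: leq_trans (leq_mul H (leqnn _)) _; rewrite big_distrl /= -sum_nat_const.
apply: leq_sum => t _.
have sz : size t = size (enum S) by rewrite size_tuple -cardE.
have := @card_constr (zip t (enum S)); rewrite -/unzip2 unzip2_zip ?sz // enum_uniq.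
by rewrite size2_zip ?sz // -cardE; apply.
Qed.
End InjCount.

(** * Hamming weight and block support *)

Section Supp.
Variables (q : nat) (I : finType).
Local Notation V := {ffun I -> 'Z_q}.
Definition supp (u : V) : {set I} := [set i | u i != 0].
Definition wt (u : V) : nat := #|supp u|.
Lemma wt0 : wt 0 = 0%N.
Proof. by apply/eqP; rewrite cards_eq0; apply/eqP/setP => i; rewrite !inE ffunE eqxx. Qed.
Lemma wt_eq0 u : (wt u == 0)%N = (u == 0).
Proof.
apply/idP/eqP => [|->]; last by rewrite wt0.
rewrite cards_eq0 => /eqP/setP u0; apply/ffunP => i; rewrite ffunE; apply/eqP.
by have := u0 i; rewrite !inE => /negbFE.
Qed.
Lemma wtN u : wt (- u) = wt u.
Proof. by apply: eq_card => i; rewrite !inE ffunE oppr_eq0. Qed.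
Lemma wtD u v : (wt (u + v)%R <= wt u + wt v)%N.
Proof.
apply: leq_trans (leq_card_setU _ _); apply: subset_leq_card; apply/subsetP => i.
rewrite !inE ffunE; apply: contraNT; rewrite negb_or !negbK => /andP[/eqP-> /eqP->].
by rewrite addr0.
Qed.
Lemma wt_le u : (wt u <= #|I|)%N. Proof. exact: max_card. Qed.

Lemma card_supp_sub (S : {set I}) : #|[set u : V | supp u \subset S]| = (#|'Z_q| ^ #|S|)%N.
Proof.
rewrite -(card_pffun_on 0 (mem S) predT) cardsE; apply: eq_card => u.
apply/idP/pffun_onP => [uS|[uS _]].
  split; last by [].
  by apply/supportP => x xS; apply/eqP; apply: contraNT xS => ux; apply: (subsetP uS); rewrite inE.
by apply/subsetP => i; rewrite inE => ui; apply: (subsetP uS).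
Qed.

(** Supports are padded to exactly h coordinates; a union bound over these sets follows. *)
Lemma card_wt_le h : (h <= #|I|)%N ->
  (#|[set u : V | wt u <= h]| <= 'C(#|I|, h) * #|'Z_q| ^ h)%N.
Proof.
move=> hI; rewrite -card_draws.
rewrite -sum_nat_const.
apply: (@leq_trans (\sum_(S in [set A : {set I} | #|A| == h]) #|[set u : V | supp u \subset S]|)%N).
  apply: (@leq_card_bigU _ _ [set u : V | (wt u <= h)%N] [set A : {set I} | #|A| == h]
    (fun S => [set u : V | supp u \subset S])) => u.
  rewrite inE => uh; have [|B uB Bh] := @superset_card _ (supp u) h.
    by rewrite uh.
  by exists B; rewrite ?inE ?Bh.
by apply: leq_sum => S; rewrite inE card_supp_sub => /eqP->.
Qed.
End Supp.

Section Blocks.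
Variables (q m k : nat).
Local Notation W := {ffun 'I_m * 'I_k -> 'Z_q}.
Implicit Types v : W.
(** The edges on which v is nonzero. Levels of frequencies count these edges rather than
    coordinates, since the k labels of an edge share one center; here k is the edge size minus
    one. *)
Definition blocks v : {set 'I_m} := [set i | [exists l, v (i, l) != 0]].

Lemma blocks_notin v i l : i \notin blocks v -> v (i, l) = 0.
Proof. by rewrite inE negb_exists => /forallP/(_ l); rewrite negbK => /eqP. Qed.

Lemma blocksP v (S : {set 'I_m}) :
  reflect (forall i l, i \notin S -> v (i, l) = 0) (blocks v \subset S).
Proof.
apply: (iffP subsetP) => [vS i l iS|vS i].
  by apply: blocks_notin; apply: contraNN iS => /vS.
by rewrite inE => /existsP[l]; apply: contraNT => /vS->.
Qed.

Lemma blocks_eq0 v : (#|blocks v| == 0)%N = (v == 0).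
Proof.
apply/idP/eqP => [|->].
  rewrite cards_eq0 => /eqP v0; apply/ffunP => -[i l].
  by rewrite ffunE blocks_notin // v0 inE.
by rewrite cards_eq0 -subset0; apply/blocksP => i l _; rewrite ffunE.
Qed.

Lemma card_blocks_sub (S : {set 'I_m}) :
  #|[set v | blocks v \subset S]| = ((#|'Z_q| ^ k) ^ #|S|)%N.
Proof.
have -> : [set v | blocks v \subset S] = [set v | supp v \subset setX S setT].
  apply/setP => v; rewrite !inE; apply/blocksP/subsetP => [vS [i l]|vS i l iS].
    by rewrite !inE andbT; apply: contraNT => /vS->.
  by apply/eqP; apply: contraNT iS => vi; have := vS (i, l); rewrite !inE andbT; apply.
by rewrite card_supp_sub cardsX cardsT (card_ord k) -expnM mulnC.
Qed.

Lemma card_blocks_eq l (S : {set 'I_m}) :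
  (#|[set v | (blocks v \subset S) && (#|blocks v| == l)]| <= 'C(#|S|, l) * (#|'Z_q| ^ k) ^ l)%N.
Proof.
rewrite -cards_draws -sum_nat_const.
apply: (@leq_trans (\sum_(U in [set A : {set 'I_m} | A \subset S & #|A| == l])
  #|[set v | blocks v \subset U]|)%N).
  apply: (@leq_card_bigU _ _ [set v | (blocks v \subset S) && (#|blocks v| == l)]
    [set A : {set 'I_m} | A \subset S & #|A| == l] (fun U => [set v | blocks v \subset U])) => v.
  rewrite inE => /andP[vS vl]; by exists (blocks v); rewrite ?inE ?vS.
by apply: leq_sum => U; rewrite inE card_blocks_sub => /andP[_ /eqP->].
Qed.
End Blocks.

(** * Folded encodings and their adjoints *)

Section Matching.
Variables (q n m k : nat).
Local Notation V := {ffun 'I_n -> 'Z_q}.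
Local Notation W := {ffun 'I_m * 'I_k -> 'Z_q}.
Local Notation pos := ('I_m * 'I_k.+1)%type.
Local Notation MM := {ffun pos -> 'I_n}.
Implicit Types (u x : V) (v w : W) (M : MM).

(* [observe M x] is A_M x and [adjoint M v] is A_M^T v; [edge_value v] gives the value
   of A_M^T v at each slot of each edge, the last slot being the center. *)
Definition observe M x : W :=
  [ffun p => x (M (p.1, lift ord_max p.2)) - x (M (p.1, ord_max))].
Definition edge_value v (p : pos) : 'Z_q :=
  if unlift ord_max p.2 is Some l then v (p.1, l) else - \sum_l v (p.1, l).
Definition adjoint M v : V := [ffun j => \sum_(p | M p == j) edge_value v p].

Lemma sum_pos (A : nmodType) (F : pos -> A) :
  \sum_p F p = \sum_i \sum_c F (i, c).
Proof. by rewrite pair_big; apply: eq_bigr => -[]. Qed.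

Lemma big_lift_max (A : nmodType) (F : 'I_k.+1 -> A) :
  \sum_c F c = \sum_l F (lift ord_max l) + F ord_max.
Proof.
rewrite big_ord_recr /=; congr (_ + _); apply: eq_bigr => l _; congr (F _).
by apply: val_inj; rewrite /= /bump leqNgt ltn_ord.
Qed.

Lemma dot_adjoint M v x : dot (adjoint M v) x = dot v (observe M x).
Proof.
rewrite /dot; under eq_bigr do rewrite ffunE mulr_suml.
rewrite (exchange_big_dep predT) //=.
rewrite (eq_bigr (fun p => edge_value v p * x (M p))); last first.
  by move=> p _; rewrite (big_pred1 (M p)) // => j; rewrite eq_sym.
rewrite sum_pos [RHS](eq_bigr (fun p => v (p.1, p.2) * observe M x (p.1, p.2))); last by case.
rewrite -(pair_big predT predT (fun i l => v (i, l) * observe M x (i, l))) /=.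
apply: eq_bigr => i _; rewrite big_lift_max /edge_value /= unlift_none.
rewrite mulNr mulr_suml -sumrB; apply: eq_bigr => l _.
by rewrite liftK ffunE mulrBr.
Qed.

Lemma edge_value0 p : edge_value 0 p = 0.
Proof.
rewrite /edge_value; case: unliftP => [l _|_]; first by rewrite ffunE.
by rewrite big1 ?oppr0 // => l _; rewrite ffunE.
Qed.
Lemma adjoint0 M : adjoint M 0 = 0.
Proof. by apply/ffunP => j; rewrite !ffunE big1 // => p _; rewrite edge_value0. Qed.

Lemma chi_observe (R : rcfType) M v x : chi R v (observe M x) = chi R (adjoint M v) x.
Proof. by rewrite /chi dot_adjoint. Qed.

Lemma edge_value_notin v i c : i \notin blocks v -> edge_value v (i, c) = 0.
Proof.
move=> iv; rewrite /edge_value /=; case: unliftP => [l _|_]; first by rewrite blocks_notin.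
by rewrite big1 ?oppr0 // => l _; rewrite blocks_notin.
Qed.
Lemma sum_edge_value v i : \sum_c edge_value v (i, c) = 0.
Proof.
rewrite big_lift_max {2}/edge_value /= unlift_none; apply/eqP; rewrite subr_eq0; apply/eqP.
by apply: eq_bigr => l _; rewrite /edge_value /= liftK.
Qed.
Lemma edge_value_ex v i : i \in blocks v -> exists c, edge_value v (i, c) != 0.
Proof.
by rewrite inE => /existsP[l vl]; exists (lift ord_max l); rewrite /edge_value /= liftK.
Qed.
(** The values of A_M^T v on an edge sum to 0, so a nonzero one cannot stand alone. Hence every edge
    used by v contributes at least 2 to the weight of A_M^T v. *)
Lemma edge_value_ex2 v i c : i \in blocks v -> exists2 c', c' != c & edge_value v (i, c') != 0.
Proof.
move=> /edge_value_ex[c1 e1]; have [c1c|] := eqVneq c1 c; last by exists c1.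
subst c1.
case: (pickP (fun c' => (c' != c) && (edge_value v (i, c') != 0))) => [c' /andP[]|no].
  by exists c'.
have := sum_edge_value v i; rewrite (bigD1 c) //= big1 => [|c' c'c].
  by rewrite addr0 => /eqP; rewrite (negPf e1).
by apply/eqP; have := no c'; rewrite c'c /= => /negbFE.
Qed.
Lemma card_edge_value_ge2 v i : i \in blocks v -> (2 <= #|[set c | edge_value v (i, c) != 0%R]|)%N.
Proof.
move=> iv; have [c1 e1] := edge_value_ex iv; have [c2 c21 e2] := edge_value_ex2 c1 iv.
have <- : #|[set c1; c2]| = 2%N by rewrite cards2 eq_sym c21.
by apply: subset_leq_card; apply/subsetP => c; rewrite !inE => /orP[]/eqP->.
Qed.

Section Inj.
Variable M : MM.
Hypothesis Minj : injective M.

Lemma adjointE v p : adjoint M v (M p) = edge_value v p.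
Proof.
rewrite ffunE (bigD1 p) //= big1 ?addr0 // => p' /andP[/eqP/Minj->].
by rewrite eqxx.
Qed.
Lemma adjoint_codom v j : j \notin codom M -> adjoint M v j = 0.
Proof.
by move=> jM; rewrite ffunE big1 // => p /eqP pj; case/negP: jM; rewrite -pj codom_f.
Qed.
Lemma supp_adjoint_codom v : {subset supp (adjoint M v) <= codom M}.
Proof. by move=> j; rewrite inE; apply: contraNT => /adjoint_codom->. Qed.

Lemma adjoint_inj : injective (adjoint M).
Proof.
move=> v v' /ffunP e; apply/ffunP => -[i l].
by have := e (M (i, lift ord_max l)); rewrite !adjointE /edge_value /= liftK.
Qed.

Lemma wt_adjoint_le v : (wt (adjoint M v) <= k.+1 * #|blocks v|)%N.
Proof.
have -> : (k.+1 * #|blocks v|)%N = #|setX (blocks v) [set: 'I_k.+1]|.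
  by rewrite cardsX cardsT card_ord mulnC.
rewrite -(card_imset _ Minj); apply: subset_leq_card; apply/subsetP => j jz.
have /codomP[[i c] jM] := supp_adjoint_codom jz.
rewrite jM mem_imset // !inE andbT; move: jz; rewrite jM inE adjointE.
by apply: contraNT => iv; rewrite edge_value_notin // inE.
Qed.

Definition touch u : {set 'I_m} := [set i | [exists c, u (M (i, c)) != 0]].
(** The vertices of supp u that share an edge with another vertex of supp u. Only on their edges can
    adding [adjoint M v] lower the number of nonzero coordinates. *)
Definition paired_part u : {set 'I_n} :=
  [set j in supp u | [exists i, exists c, exists c',
    [&& c != c', M (i, c) == j & u (M (i, c')) != 0]]].

Lemma card_by_edges (Q : pred 'I_n) :
  #|[set j | Q j]| = (#|[set j | (j \notin codom M) && Q j]| +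
     \sum_i #|[set c : 'I_k.+1 | Q (M (i, c))]|)%N.
Proof.
rewrite -(cardsID [set j | j \notin codom M]); congr (_ + _)%N.
  by apply: eq_card => j; rewrite !inE andbC.
transitivity #|[set p : pos | Q (M p)]|.
  rewrite -(card_imset _ Minj); apply: eq_card => j; rewrite !inE negbK.
  apply/andP/imsetP => [[/codomP[p ->] Qp]|[p]]; first by exists p; rewrite ?inE.
  by rewrite inE => Qp ->; rewrite codom_f.
rewrite -sum1dep_card (eq_bigl (fun p : pos => Q (M (p.1, p.2)))); last by case.
rewrite -(pair_big_dep predT (fun i c => Q (M (i, c))) (fun _ _ => 1%N)) /=.
by apply: eq_bigr => i _; rewrite sum1dep_card.
Qed.

Lemma card_touch u : (#|touch u| <= wt u)%N.
Proof.
apply: (@leq_trans #|[set p | u (M p) != 0]|).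
  apply: (@leq_trans #|[set p.1 | p in [set p | u (M p) != 0]]|).
    apply: subset_leq_card; apply/subsetP => i; rewrite inE => /existsP[c uc].
    by apply/imsetP; exists (i, c); rewrite ?inE.
  exact: leq_imset_card.
rewrite -(card_imset _ Minj); apply: subset_leq_card; apply/subsetP => j.
by case/imsetP => p; rewrite !inE => up ->.
Qed.

(** Edge by edge: an edge of v free of supp u gains two nonzero coordinates; an edge with a single
    vertex of supp u keeps at least one, by [edge_value_ex2]; the vertices of the other edges are
    written off in [paired_part]; vertices outside the matching do not change. *)
Lemma wt_add_adjoint_ge u v :
  (wt u + 2 * #|blocks v :\: touch u| <= wt (u + adjoint M v)%R + #|paired_part u|)%N.
Proof.
have Lsub : paired_part u \subset supp u by apply/subsetP => j; rewrite inE => /andP[].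
have -> : wt u = (#|[set j | (u j != 0)%R && (j \notin paired_part u)]| + #|paired_part u|)%N.
  rewrite /wt -(cardsID (paired_part u) (supp u)) addnC; congr (_ + _)%N.
    by apply: eq_card => j; rewrite !inE andbC.
  by rewrite (setIidPr Lsub).
rewrite addnAC leq_add2r.
rewrite card_by_edges /wt /supp [leqRHS]card_by_edges -addnA leq_add //.
  apply: subset_leq_card; apply/subsetP => j; rewrite !inE => /andP[jM /andP[uj _]].
  by rewrite jM ffunE adjoint_codom // addr0.
have -> : (2 * #|blocks v :\: touch u| = \sum_i (if i \in blocks v :\: touch u then 2 else 0))%N.
  by rewrite -big_mkcond sum_nat_const mulnC.
rewrite -big_split /=; apply: leq_sum => i _.
rewrite !inE; have [/existsP[c0 uc0]|it] /= := boolP [exists c, u (M (i, c)) != 0].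
  rewrite addn0.
  set B := [set c | (u + adjoint M v) _ != 0].
  set A := [set c | _].
  have [->|[c]] := set_0Vmem A; first by rewrite cards0.
  rewrite inE => /andP[uc cL].
  have only c' : c' != c -> u (M (i, c')) = 0.
    move=> c'c; apply/eqP; apply: contraNT cL => uc'.
    rewrite !inE uc; apply/existsP; exists i; apply/existsP; exists c.
    by apply/existsP; exists c'; rewrite eq_sym c'c eqxx.
  have -> : A = [set c].
    apply/setP => c'; rewrite !inE; have [->|/only->] := eqVneq c' c.
      by rewrite uc /=; move: cL; rewrite inE inE uc.
    by rewrite eqxx.
  rewrite cards1 card_gt0; apply/set0Pn.
  have [iv|iv] := boolP (i \in blocks v); last first.
    by exists c; rewrite inE ffunE adjointE edge_value_notin // addr0.
  have [c' c'c e] := edge_value_ex2 c iv.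
  by exists c'; rewrite inE ffunE only // adjointE add0r.
have u0 c : u (M (i, c)) = 0.
  by move: it; rewrite negb_exists => /forallP/(_ c)/negPn/eqP.
rewrite (_ : [set c | _] = set0) ?cards0 ?add0n; last by apply/setP => c; rewrite !inE u0 eqxx.
case: ifP => // iv.
have {}iv : i \in blocks v by rewrite inE.
apply: leq_trans (card_edge_value_ge2 iv) _.
by apply: subset_leq_card; apply/subsetP => c; rewrite !inE ffunE u0 adjointE add0r.
Qed.

Lemma wt_add_adjoint_le u v :
  (wt (u + adjoint M v)%R <= wt u + k.+1 * (wt u + #|blocks v :\: touch u|))%N.
Proof.
apply: leq_trans (wtD _ _) _; rewrite leq_add2l.
apply: leq_trans (wt_adjoint_le v) _; rewrite leq_mul2l /= -(cardsID (touch u)) leq_add2r.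
by apply: leq_trans (card_touch u); apply: subset_leq_card; apply: subsetIr.
Qed.
End Inj.

(** The property of [paired_part M u] that mentions only the set, so that a union bound over the
    subsets S of supp u becomes possible. *)
Definition paired M (S : {set 'I_n}) :=
  [forall j in S, exists i, exists c, exists c',
    [&& c != c', M (i, c) == j & M (i, c') \in S]].

Lemma paired_partP M u : paired M (paired_part M u).
Proof.
apply/forall_inP => j; rewrite !inE => /andP[uj].
case/existsP => i /existsP[c] /existsP[c'] /and3P[cc' Mj uc'].
apply/existsP; exists i; apply/existsP; exists c; apply/existsP; exists c'.
rewrite cc' Mj !inE uc' /=; apply/existsP; exists i; apply/existsP; exists c'.
by apply/existsP; exists c; rewrite eq_sym cc' eqxx (eqP Mj).
Qed.

Local Notation inj := [set M : MM | injectiveb M].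

Lemma codom_tuple M (S : {set 'I_n}) : S \subset codom M ->
  exists t : #|S|.-tuple pos, map M t = enum S.
Proof.
move=> /subsetP SM.
have H (s : seq 'I_n) : {subset s <= codom M} -> exists t : seq pos, map M t = s.
  elim: s => [|j s IH] sM; first by exists [::].
  have [t <-] := IH (fun y ys => sM y (mem_behead (s := j :: s) ys)).
  have /codomP[p ->] := sM j (mem_head _ _).
  by exists (p :: t).
have [j|t tS] := H (enum S); first by rewrite mem_enum => /SM.
have tsz : size t == #|S| by rewrite cardE -tS size_map.
by exists (Tuple tsz).
Qed.

Lemma card_cover (S : {set 'I_n}) :
  (#|[set M in inj | S \subset codom M]| * n ^_ #|S| <= (m * k.+1) ^ #|S| * #|inj|)%N.
Proof.
have := @card_inj_tuple_bound _ _ S [set M in inj | S \subset codom M] setT.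
rewrite card_ord cardsT card_tuple card_prod !card_ord; apply => [M|M].
  by rewrite !inE => /andP[].
rewrite !inE => /andP[_ /codom_tuple[t tS]]; by exists t; rewrite ?inE.
Qed.

Lemma card_all_tuple (X : finType) (A : {set X}) r :
  (#|[set t : r.-tuple X | all (mem A) t]| <= #|A| ^ r)%N.
Proof.
have -> : (#|A| ^ r)%N = #|{: r.-tuple {y | y \in A}}| by rewrite card_tuple card_sig.
rewrite -cardsT.
apply: leq_trans (leq_imset_card (fun t : r.-tuple {y | y \in A} => map_tuple val t) _).
apply: subset_leq_card; apply/subsetP => t; rewrite inE => /allP tA.
have H (s : seq X) : {in s, forall y, y \in A} -> exists s' : seq {y | y \in A}, map val s' = s.
  elim: s => [|z s IH] sA; first by exists [::].
  have [s' <-] := IH (fun y ys => sA y (mem_behead (s := z :: s) ys)).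
  by exists (exist _ z (sA z (mem_head _ _)) :: s').
have [s' s't] := H _ tA.
have sz : size s' == r by rewrite -(size_map val) s't size_tuple.
by apply/imsetP; exists (Tuple sz) => //; apply/val_inj.
Qed.

Lemma paired_edges M (S : {set 'I_n}) : injective M -> paired M S ->
  (2 * #|[set i | [exists c, M (i, c) \in S]]| <= #|S|)%N.
Proof.
move=> Mi /forall_inP pS; rewrite -[S in leqRHS]setIT.
have -> : #|S :&: setT| = #|[set j | j \in S]| by apply: eq_card => j; rewrite !inE andbT.
rewrite (card_by_edges Mi); apply: leq_trans (leq_addl _ _).
rewrite mulnC -sum_nat_const big_mkcond /=; apply: leq_sum => i _.
case: ifP => //; rewrite inE => /existsP[c Mc].
have /existsP[i' /existsP[c1 /existsP[c2 /and3P[c12 /eqP/Mi[ii no_prob] Mc2]]]] := pS _ Mc.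
subst i' c1; have <- : #|[set c; c2]| = 2%N by rewrite cards2 c12.
by apply: subset_leq_card; apply/subsetP => c'; rewrite !inE => /orP[]/eqP->.
Qed.

(** Each edge meeting a paired S contains two of its vertices, so all preimages of S are slots of
    some #|S|./2 edges, after padding. The tuples of such slots are counted and
    [card_inj_tuple_bound] applies. *)
Lemma card_paired (S : {set 'I_n}) : ((#|S|)./2 <= m)%N ->
  (#|[set M in inj | paired M S]| * n ^_ #|S| <=
   'C(m, (#|S|)./2) * ((#|S|)./2 * k.+1) ^ #|S| * #|inj|)%N.
Proof.
move=> em; set e := (#|S|)./2 in em *; set r := #|S|.
pose A (E : {set 'I_m}) : {set pos} := setX E setT.
pose TS := [set t : #|S|.-tuple pos | [exists E : {set 'I_m}, (#|E| == e) && all (mem (A E)) t]].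
have cTS : (#|TS| <= 'C(m, e) * (e * k.+1) ^ r)%N.
  rewrite -[m in 'C(m, _)]card_ord -card_draws -sum_nat_const.
  apply: (@leq_trans (\sum_(E in [set E : {set 'I_m} | #|E| == e])
    #|[set t : #|S|.-tuple pos | all (mem (A E)) t]|)%N).
    apply: (@leq_card_bigU _ _ TS [set E : {set 'I_m} | #|E| == e]
      (fun E => [set t : #|S|.-tuple pos | all (mem (A E)) t])) => t.
    by rewrite inE => /existsP[E /andP[Ee Et]]; exists E; rewrite inE.
  apply: leq_sum => E; rewrite inE => /eqP Ee.
  by apply: leq_trans (card_all_tuple _ _) _; rewrite cardsX cardsT card_ord Ee.
have := @card_inj_tuple_bound _ _ S [set M in inj | paired M S] TS.
rewrite card_ord => H; apply: leq_trans (H _ _) _; last by rewrite leq_mul2r cTS orbT.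
  by move=> M; rewrite !inE => /andP[].
move=> M; rewrite !inE => /andP[/injectiveP Mi Mp].
have [|t tS] := @codom_tuple M S.
  apply/subsetP => j /(forall_inP Mp)/existsP[i /existsP[c /existsP[c' /and3P[_ /eqP<- _]]]].
  exact: codom_f.
exists t => //; rewrite inE.
have [|E E1 Ee] := @superset_card _ [set i | [exists c, M (i, c) \in S]] e.
  rewrite card_ord em andbT; by rewrite /e geq_half_double -mul2n paired_edges.
apply/existsP; exists E; rewrite Ee eqxx; apply/allP => -[i c] ict.
rewrite !inE andbT; apply: (subsetP E1); rewrite inE; apply/existsP; exists c.
by rewrite -mem_enum -tS; apply: map_f.
Qed.
End Matching.

(** * Fourier mass of messages on a level *)

Lemma bernoulli (R : realFieldType) (z : R) p : -1 <= z -> 1 + p%:R * z <= (1 + z) ^+ p.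
Proof.
move=> z1; elim: p => [|p IH]; first by rewrite mul0r addr0 expr0.
rewrite exprSr; apply: (@le_trans _ _ ((1 + p%:R * z) * (1 + z))).
  rewrite -natr1 -subr_ge0.
  have -> : (1 + p%:R * z) * (1 + z) - (1 + (p%:R + 1) * z) = p%:R * z ^+ 2 by ring.
  by rewrite mulr_ge0 ?ler0n ?sqr_ge0.
by rewrite ler_wpM2r //; lra.
Qed.

(** Bernoulli's inequality at the mean mu gives a tangent line below each power, and the linear
    terms average to zero. *)
Lemma power_mean (R : realFieldType) (X : finType) (x : X -> R) p :
  (0 < #|X|)%N -> (forall i, 0 <= x i) ->
  ((#|X|%:R)^-1 * \sum_i x i) ^+ p <= (#|X|%:R)^-1 * \sum_i x i ^+ p.
Proof.
move=> X0 x0; set N : R := #|X|%:R; have N0 : 0 < N by rewrite ltr0n.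
set mu := N^-1 * _; have mu0 : 0 <= mu by rewrite mulr_ge0 ?invr_ge0 ?(ltW N0) ?sumr_ge0.
have [mu_eq0|mun0] := eqVneq mu 0.
  case: p => [|p]; last first.
    rewrite mu_eq0 expr0n mulr_ge0 ?invr_ge0 ?(ltW N0) ?sumr_ge0 // => i _.
    by rewrite exprn_ge0.
  under eq_bigr do rewrite expr0; rewrite expr0 sumr_const -/N mulVf ?gt_eqF //.
have mup : 0 < mu by rewrite lt_def mun0.
have H i : mu ^+ p * (1 + p%:R * (x i / mu - 1)) <= x i ^+ p.
  have -> : x i ^+ p = mu ^+ p * (1 + (x i / mu - 1)) ^+ p.
    by rewrite -exprMn; congr (_ ^+ _); field.
  rewrite ler_wpM2l ?exprn_ge0 // bernoulli // -subr_ge0 opprK subrK.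
  by rewrite divr_ge0.
rewrite ler_pdivlMl //.
apply: le_trans (ler_sum _ (fun i _ => H i)).
rewrite -mulr_sumr big_split /= sumr_const -mulr_sumr sumrB -mulr_suml sumr_const -/N.
have -> : \sum_i x i = N * mu by rewrite /mu mulVKf ?gt_eqF.
by rewrite mulfK // subrr mulr0 addr0 mulrC.
Qed.

Lemma leq_expl a b e : (a <= b)%N -> (a ^ e <= b ^ e)%N.
Proof. by case: e => // e ab; rewrite leq_exp2r. Qed.

Section Level.
Variables (R : rcfType) (q m k : nat) (Msg : finType).
Local Notation C := (R[i]).
Local Notation W := {ffun 'I_m * 'I_k -> 'Z_q}.
Implicit Types (G : W -> Msg) (v w : W).

Definition ind G (a : Msg) : W -> C := fun w => (G w == a)%:R.
Local Notation Q := (#|'Z_q| ^ k)%N.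

(** In the expansion of the 2r-th power of a modulus, the factors labelled [true] are conjugated and
    those labelled [false] are not, so their frequencies enter with opposite signs. *)
Definition sgn (b : bool) v : W := if b then v else - v.

(** There are as many conjugated as unconjugated factors, so a common shift cancels; this makes the
    moment bound uniform in [v0]. *)
Lemma sum_sgn_const r v : \sum_(p : bool * 'I_r) sgn p.1 v = 0.
Proof.
rewrite -(pair_bigA _ (fun b (_ : 'I_r) => sgn b v)) /= big_bool /= !sumr_const.
by rewrite -mulrnDl subrr mul0rn.
Qed.

(* The tuples surviving in the expansion of the 2r-th moment of a sum of characters of
   level l: every block they touch is touched twice, hence at most r l blocks are. *)
Definition balanced l r : {set {ffun bool * 'I_r -> W}} :=
  [set f | (f \in ffun_on [pred v | #|blocks v| == l]) &&
     (\sum_p sgn p.1 (f p) == 0)].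

(** The first factor chooses r l blocks containing all those used; each of the 2r entries then
    chooses its l blocks among them and its values there. *)
Lemma card_balanced l r : (r * l <= m)%N ->
  (#|balanced l r| <= 'C(m, r * l) * ('C(r * l, l) * Q ^ l) ^ (2 * r))%N.
Proof.
move=> rl; rewrite -[m in 'C(m, _)]card_ord -card_draws -sum_nat_const.
pose F (U : {set 'I_m}) : {set {ffun bool * 'I_r -> W}} :=
  [set f in ffun_on (mem [set v | (blocks v \subset U) && (#|blocks v| == l)])].
apply: (@leq_trans (\sum_(U in [set A : {set 'I_m} | #|A| == (r * l)%N]) #|F U|)%N); last first.
  apply: leq_sum => U; rewrite inE => /eqP Ul.
  rewrite cardsE card_ffun_on card_prod card_bool (card_ord r) leq_expl //.
  by rewrite -Ul card_blocks_eq.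
apply: (@leq_card_bigU _ _ (balanced l r) [set A : {set 'I_m} | #|A| == (r * l)%N] F) => f.
rewrite inE => /andP[/ffun_onP fl /eqP f0].
have fl' p : #|blocks (f p)| = l by have := fl p; rewrite inE => /eqP.
pose U0 := \bigcup_p blocks (f p).
have U0r : (2 * #|U0| <= 2 * (r * l))%N.
  have -> : (2 * (r * l) = \sum_(p : bool * 'I_r) #|blocks (f p)|)%N.
    under eq_bigr do rewrite fl'.
    by rewrite sum_nat_const card_prod card_bool card_ord mulnA.
  rewrite mulnC -sum_nat_const.
  under [leqRHS]eq_bigr => p _ do rewrite -sum1_card big_mkcond /=.
  rewrite exchange_big /= big_mkcond /=; apply: leq_sum => i _.
  case: ifP => // /bigcupP[p _ ip].
  have [l0 fp0] : exists l0, f p (i, l0) != 0 by apply/existsP; move: ip; rewrite inE.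
  (* A coordinate at which a single entry is nonzero would survive in the signed sum. *)
  have [p' p'p fp'0] : exists2 p', p' != p & f p' (i, l0) != 0.
    apply/exists_inP; apply: contraNT fp0; rewrite negb_exists => /forallP np.
    have E b v : (sgn b v (i, l0) == 0) = (v (i, l0) == 0).
      by case: b; rewrite /sgn ?ffunE ?oppr_eq0.
    have /ffunP/(_ (i, l0)) := f0; rewrite sum_ffunE ffunE (bigD1 p) //= big1 => [|p' p'p].
      by rewrite addr0 => /eqP; rewrite E.
    by have := np p'; rewrite negb_and p'p /= negbK -(E p'.1) => /eqP.
  rewrite (bigD1 p) //= ip (bigD1 p') //=.
  by rewrite [i \in blocks (f p')]inE (introT existsP) //; exists l0.
have [|U UU Ur] := @superset_card _ U0 (r * l)%N.
  by rewrite card_ord rl andbT; move: U0r; rewrite leq_pmul2l.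
exists U; first by rewrite inE Ur.
rewrite inE; apply/ffun_onP => p; rewrite inE fl' eqxx andbT.
by apply: subset_trans UU; rewrite /U0 (bigcup_sup p).
Qed.

(* The shift [v0] absorbs the part of a frequency that lives on the edges meeting the
   support of u. *)
Definition level_mass G l v0 : R :=
  \sum_a \sum_(v | #|blocks v| == l) nm (fc (ind G a) (v0 + v)).

Lemma level_mass_ge0 G l v0 : 0 <= level_mass G l v0.
Proof. by apply: sumr_ge0 => a _; apply: sumr_ge0 => v _; exact: nm_ge0. Qed.

Lemma card_labels_gt0 : (0 < #|{: W}|)%N.
Proof. by apply/card_gt0P; exists 0. Qed.

(** A coefficient of an indicator is at most the measure of its set, and the sets of the different
    messages partition the space. *)
Lemma sum_ind_nm_le1 G s : \sum_a nm (fc (ind G a) s) <= 1 :> R.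
Proof.
apply: (@le_trans _ _ (\sum_a (#|{: W}|%:R)^-1 * \sum_w (G w == a)%:R)).
  apply: ler_sum => a _; rewrite /fc nmM nmV nm_nat ler_wpM2l ?invr_ge0 //.
  apply: le_trans (nm_sum _ _) _; apply: ler_sum => w _.
  by rewrite nmM nm_chi mulr1 /ind nm_nat.
rewrite -mulr_sumr exchange_big /=.
rewrite (eq_bigr (fun=> 1)) => [|w _]; last first.
  by rewrite (bigD1 (G w)) //= eqxx big1 ?addr0 // => a; rewrite eq_sym => /negPf->.
by rewrite sumr_const mulVf // pnatr_eq0 -lt0n card_labels_gt0.
Qed.

Lemma level_mass0 G v0 : level_mass G 0 v0 <= 1.
Proof.
rewrite /level_mass; under eq_bigr => a _.
  rewrite (big_pred1 (0 : W)); last by move=> v; rewrite blocks_eq0.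
  rewrite addr0; over.
exact: sum_ind_nm_le1.
Qed.

(** After expanding the power, averaging over w kills every tuple of frequencies whose signed sum is
    nonzero; the balanced tuples remain, with coefficients of modulus at most 1. *)
Lemma sum_moment (P : W -> C) (E : W -> C) l v0 r :
  (forall v, nm (E v) <= 1) ->
  (P =1 fun w => \sum_(v | #|blocks v| == l) E v * chi R (- (v0 + v)) w) ->
  (#|{: W}|%:R)^-1 * \sum_w nm (P w) ^+ (2 * r) <= #|balanced l r|%:R :> R.
Proof.
move=> E1 PE.
pose e (b : bool) v : C := if b then (E v)^* else E v.
have e1 b v : nm (e b v) <= 1 by case: b; rewrite /= ?nm_conj.
have powE w : (nm (P w) ^+ (2 * r))%:C%C =
    \sum_(f in ffun_on [pred v | #|blocks v| == l])
      (\prod_p e p.1 (f p)) * chi R (\sum_(p : bool * 'I_r) sgn p.1 (f p)) w.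
  have -> : (nm (P w) ^+ (2 * r))%:C%C = \prod_(p : bool * 'I_r) (if p.1 then (P w)^* else P w).
    rewrite -(pair_bigA _ (fun b (_ : 'I_r) => if b then (P w)^* else P w)) /=.
    rewrite big_bool /= !prodr_const card_ord -exprMn [_^* * _]mulrC -sqr_nm.
    by rewrite exprM rmorphXn.
  rewrite (eq_bigr (fun p : bool * 'I_r => \sum_(v | [pred v | #|blocks v| == l] v)
     e p.1 v * chi R (sgn p.1 (v0 + v)) w)) => [|[b i] _]; last first.
    rewrite PE; case: b => //=; rewrite rmorph_sum; apply: eq_bigr => v _.
    by rewrite rmorphM /= chiN conjCK.
  rewrite bigA_distr_big /=; apply: eq_bigr => f _.
  rewrite big_split /=; congr (_ * _).
  have -> : \sum_(p : bool * 'I_r) sgn p.1 (f p) = \sum_(p : bool * 'I_r) sgn p.1 (v0 + f p).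
    have sgD b v v' : sgn b (v + v') = sgn b v + sgn b v' by case: b; rewrite //= /sgn opprD.
    by under [RHS]eq_bigr do rewrite sgD; rewrite big_split /= sum_sgn_const add0r.
  rewrite /chi /dot -unity_char_sum; congr unity_char; rewrite exchange_big /=.
  by apply: eq_bigr => i _; rewrite sum_ffunE mulr_suml.
rewrite -(@ger0_norm _ (_ * _)); last first.
  by rewrite mulr_ge0 ?invr_ge0 ?ler0n ?sumr_ge0 // => w _; rewrite exprn_ge0 ?nm_ge0.
rewrite -nm_real rmorphM fmorphV rmorph_nat rmorph_sum.
rewrite (eq_bigr _ (fun w _ => powE w)).
rewrite exchange_big /= nmM nmV nm_nat ler_pdivrMl ?ltr0n ?card_labels_gt0 //.
apply: le_trans (nm_sum _ _) _.
rewrite -[#|balanced l r|]sum1_card natr_sum mulr_sumr.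
rewrite [leRHS](eq_bigl (fun f : {ffun bool * 'I_r -> W} => (f \in ffun_on [pred v | #|blocks v| == l]) &&
     (\sum_p sgn p.1 (f p) == 0))) => [|f]; last by rewrite inE.
rewrite big_mkcondr /=; apply: ler_sum => f _.
rewrite -mulr_sumr nmM sum_chi; case: ifP => _; last by rewrite nm0 mulr0.
rewrite mulr1 /cV nm_nat ler_piMl ?ler0n // nm_prod.
by apply: prodr_ile1 => p; rewrite nm_ge0 e1.
Qed.

(** Phases turn the mass into the average of [P (G w) w], in which every w counts for one message
    only. Power mean, followed by bounding the term of [G w] by the sum over all messages, costs a
    factor #|Msg| on the 2r-th power. *)
Lemma level_mass_moment G l v0 r : (0 < r)%N ->
  level_mass G l v0 ^+ (2 * r) <= (#|Msg| * #|balanced l r|)%:R.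
Proof.
move=> r0.
pose E a v : C := s2val (exists_phase (fc (ind G a) (v0 + v))).
have E1 a v : nm (E a v) <= 1 by rewrite /E; case: exists_phase.
have E2 a v : E a v * fc (ind G a) (v0 + v) = (nm (fc (ind G a) (v0 + v)))%:C%C.
  by rewrite /E; case: exists_phase.
pose P a w : C := \sum_(v | #|blocks v| == l) E a v * chi R (- (v0 + v)) w.
have levE : (level_mass G l v0)%:C%C = (cV R q ('I_m * 'I_k)%type)^-1 * \sum_w P (G w) w.
  transitivity (\sum_a \sum_(v | #|blocks v| == l) E a v * fc (ind G a) (v0 + v)).
    rewrite /level_mass rmorph_sum; apply: eq_bigr => a _; rewrite rmorph_sum.
    by apply: eq_bigr => v _; rewrite E2.
  rewrite /fc; under eq_bigr => a _ do (under eq_bigr do rewrite mulrCA mulr_sumr).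
  under eq_bigr do rewrite -mulr_sumr exchange_big.
  rewrite -mulr_sumr exchange_big; congr (_ * _); apply: eq_bigr => w _.
  rewrite (bigD1 (G w)) //= [X in _ + X]big1 ?addr0 => [|a /negPf aG].
    by apply: eq_bigr => v _; rewrite /ind eqxx mul1r.
  by rewrite big1 // => v _; rewrite /ind [G w == a]eq_sym aG mul0r mulr0.
have H : level_mass G l v0 <= (#|{: W}|%:R)^-1 * \sum_w nm (P (G w) w).
  rewrite -[level_mass _ _ _](@ger0_norm _ _ (level_mass_ge0 _ _ _)) -nm_real levE nmM nmV nm_nat.
  by rewrite ler_wpM2l ?invr_ge0 ?ler0n // nm_sum.
have H2 := lerXn2r (2 * r) (level_mass_ge0 G l v0) (le_trans (level_mass_ge0 G l v0) H) H.
apply: le_trans H2 _; apply: le_trans (power_mean _ card_labels_gt0 _) _ => [w|]; first exact: nm_ge0.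
apply: (@le_trans _ _ (\sum_a ((#|{: W}|%:R)^-1 * \sum_w nm (P a w) ^+ (2 * r)))).
  rewrite -mulr_sumr ler_wpM2l ?invr_ge0 ?ler0n // exchange_big; apply: ler_sum => w _.
  rewrite (bigD1 (G w)) //= lerDl; apply: sumr_ge0 => a _; rewrite exprn_ge0 ?nm_ge0 //.
rewrite natrM.
apply: (@le_trans _ _ (\sum_(a : Msg) #|balanced l r|%:R)).
  by apply: ler_sum => a _; apply: (@sum_moment _ (E a) l v0).
by rewrite sumr_const mulr_natl.
Qed.

(** An r-th root of the moment bound: since #|Msg| <= 2^(r l), the number of messages costs only
    2^l. *)
Lemma level_mass_sqr_bound G l v0 r : (0 < l)%N -> (0 < r)%N -> (r * l <= m)%N ->
  (#|Msg| <= 2 ^ (r * l))%N ->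
  level_mass G l v0 ^+ 2 * (l ^ l)%:R <= ((128 * Q ^ 2 * m * r) ^ l)%:R.
Proof.
move=> l0 r0 rl Nb.
have key : (#|Msg| * #|balanced l r| * l ^ (r * l) <= (128 * Q ^ 2 * m * r) ^ (r * l))%N.
  have c1 := card_balanced rl.
  have c2 := leq_bin_expn m (r * l).
  have c3 : ('C(r * l, l) <= (4 * r) ^ l)%N.
    have := leq_bin_expn (r * l) l.
    by rewrite mulnA [X in (_ <= X)%N]expnMn leq_pmul2r // expn_gt0 l0.
  (* The extra power of r makes (r l)^(r l), which the bound on C(m, r l) absorbs. The constant is
     128 = 2 * 4^2 * 4. *)
  rewrite -(@leq_pmul2r (r ^ (r * l))) ?expn_gt0 ?r0 //.
  rewrite -mulnA -expnMn [(l * r)%N]mulnC.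
  apply: (@leq_trans (2 ^ (r * l) * ('C(m, r * l) * ((4 * r * Q) ^ l) ^ (2 * r)) * (r * l) ^ (r * l))%N).
    rewrite leq_mul2r; apply/orP; right; apply: leq_mul => //.
    apply: leq_trans c1 _; rewrite leq_mul2l; apply/orP; right; apply: leq_expl.
    by rewrite [((4 * r * Q) ^ l)%N]expnMn leq_mul2r c3 orbT.
  apply: (@leq_trans (2 ^ (r * l) * (((4 * r * Q) ^ l) ^ (2 * r)) * (4 * m) ^ (r * l))%N).
    by rewrite mulnCA -!mulnA [X in (X <= _)%N]mulnCA leq_mul2l mulnCA leq_mul2l c2 !orbT.
  rewrite -(expnM (4 * r * Q)).
  have -> : (l * (2 * r) = 2 * (r * l))%N by lia.
  rewrite [((4 * r * Q) ^ _)%N]expnM -!expnMn leq_expl //.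
  by move: (Q) => x; rewrite !expnS expn0 !muln1; lia.
have {}key : (level_mass G l v0 ^+ 2 * (l ^ l)%:R) ^+ r <= (((128 * Q ^ 2 * m * r) ^ l)%:R : R) ^+ r.
  rewrite exprMn -exprM -!natrX -(expnM l) -(expnM (128 * Q ^ 2 * m * r)).
  apply: le_trans (ler_wpM2r _ (level_mass_moment _ _ _ r0)) _; first exact: ler0n.
  by rewrite -natrM ler_nat !(mulnC l).
by move: key; rewrite ler_pXn2r // nnegrE ?ler0n // mulr_ge0 ?ler0n // exprn_ge0 // level_mass_ge0.
Qed.
End Level.

(** * Weights and covering probabilities *)

Section Weight.
Variables (R : rcfType) (n : nat).
Hypothesis n0 : (0 < n)%N.

(** For h <= n this is C(n, h)^(-1/2) up to a factor exponential in h. *)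
Definition wgt h : R := Num.sqrt (h`!%:R / n%:R ^+ h).
Lemma wgt_ge0 h : 0 <= wgt h. Proof. exact: sqrtr_ge0. Qed.
Lemma sqr_wgt h : wgt h ^+ 2 = h`!%:R / n%:R ^+ h.
Proof. by rewrite sqr_sqrtr // divr_ge0 ?exprn_ge0 ?ler0n. Qed.
Lemma wgt0 : wgt 0 = 1. Proof. by rewrite /wgt fact0 expr0 divr1 sqrtr1. Qed.
Lemma ler_sqr_ge0 (x y : R) : 0 <= y -> x ^+ 2 <= y ^+ 2 -> x <= y.
Proof.
move=> y0 xy; case: (lerP 0 x) => [x0|/ltW x0]; last exact: le_trans y0.
by move: xy; rewrite ler_pXn2r.
Qed.
Lemma wgt_mono a b : (a <= b <= n)%N -> wgt b <= wgt a.
Proof.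
case/andP; elim: b => [|b IH]; first by rewrite leqn0 => /eqP->.
rewrite leq_eqVlt => /predU1P[-> //|]; rewrite ltnS => ab bn.
apply: le_trans (IH ab (ltnW bn)); apply: ler_sqr_ge0; rewrite ?wgt_ge0 // !sqr_wgt.
rewrite factS exprS natrM invfM mulrACA -[leRHS]mul1r ler_wpM2r //.
  by rewrite divr_ge0 ?exprn_ge0 ?ler0n.
by rewrite ler_pdivrMr ?ltr0n // mul1r ler_nat.
Qed.
Lemma wgt_le1 h : (h <= n)%N -> wgt h <= 1.
Proof. by move=> hn; rewrite -wgt0; apply: wgt_mono. Qed.
Lemma wgtM r a : wgt r * wgt a <= wgt (r + a).
Proof.
apply: ler_sqr_ge0; rewrite ?wgt_ge0 // exprMn !sqr_wgt mulrACA -invfM -exprD.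
rewrite ler_wpM2r ?invr_ge0 ?exprn_ge0 ?ler0n // -natrM ler_nat.
have := bin_fact (leq_addr a r); rewrite addKn => <-.
by rewrite leq_pmull // bin_gt0 leq_addr.
Qed.
(** A converse of [wgtM]: the loss is the square root of a binomial coefficient that is at most 2^(h
    + 2 l). *)
Lemma wgtD h l : wgt (h + 2 * l) <= 2 ^+ (h + l) * (wgt h * wgt (2 * l)).
Proof.
apply: ler_sqr_ge0; first by rewrite !mulr_ge0 ?exprn_ge0 ?wgt_ge0.
rewrite !exprMn !sqr_wgt [_ / _ * _]mulrACA -invfM -exprD mulrA.
rewrite ler_wpM2r ?invr_ge0 ?exprn_ge0 ?ler0n // -!natrX -!natrM ler_nat.
have := bin_fact (leq_addr (2 * l) h); rewrite addKn => <-.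
rewrite leq_mul2r; apply/orP; right; rewrite -expnM.
apply: (@leq_trans (2 ^ (h + 2 * l))); last by rewrite leq_exp2l //; lia.
rewrite (_ : 2 ^ (h + 2 * l) = (1 + 1) ^ (h + 2 * l))%N // expnDn.
have lt : (h < (h + 2 * l).+1)%N by lia.
rewrite (bigD1 (Ordinal lt)) //= !exp1n !muln1; exact: leq_addr.
Qed.
End Weight.

Lemma leq_fact_half r : (r`! <= 4 ^ r * (r./2`! ^ 2))%N.
Proof.
set e := r./2; have er : (e <= r)%N by rewrite /e; lia.
rewrite -(bin_fact er) (_ : (4 = 2 * 2)%N) // expnMn -mulnA.
have b1 : ('C(r, e) <= 2 ^ r)%N.
  rewrite -[2%N]/(1 + 1)%N expnDn.
  have lt : (e < r.+1)%N by lia.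
  rewrite (bigD1 (Ordinal lt)) //= !exp1n !muln1; exact: leq_addr.
have b2 : ((r - e)`! <= 2 ^ r * e`!)%N.
  have [->|->] : (r - e = e \/ r - e = e.+1)%N by rewrite /e; lia.
    by rewrite leq_pmull // expn_gt0.
  rewrite factS leq_mul2r; apply/orP; right.
  by apply: leq_trans (ltn_expl e (ltnSn 1)) _; rewrite leq_exp2l.
apply: leq_mul => //; rewrite expnS expn1 mulnCA leq_mul2l; apply/orP; right; exact: b2.
Qed.

Section Key.
Variables (R : rcfType) (q n m k : nat) (Msg : finType).
Local Notation C := (R[i]).
Local Notation V := {ffun 'I_n -> 'Z_q}.
Local Notation W := {ffun 'I_m * 'I_k -> 'Z_q}.
Local Notation pos := ('I_m * 'I_k.+1)%type.
Local Notation MM := {ffun pos -> 'I_n}.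
Local Notation inj := [set M : MM | injectiveb M].
Local Notation Q := (#|'Z_q| ^ k)%N.
Local Notation wgt := (@wgt R n).
Implicit Types (M : MM) (u : V) (v : W) (G : W -> Msg).
Hypotheses (n0 : (0 < n)%N) (mn : (m <= n)%N).

(** The 8 is the square root of 4^2 * 4, where 4^2 comes from squaring [leq_expnn_fact] and 4 from
    [leq_fact_half]. *)
Definition pair_const : nat := 8 * k.+1.

(* The edges meeting S are at most #|S|/2: choose them, then a slot for each vertex. *)
Lemma prob_paired (S : {set 'I_n}) : (#|S|./2 <= m)%N -> (2 * #|S| <= n)%N ->
  #|[set M in inj | paired M S]|%:R <= pair_const%:R ^+ #|S| * wgt #|S| * #|inj|%:R :> R.
Proof.
move=> em rn; have := @card_paired n m k S em; set r := #|S|; set e := r./2.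
set A := #|_|; set B := #|_|; move=> AB.
have nr := leq_expn_ffact rn; rewrite -/r in nr.
have c0 : (A * e`! * n ^ r <= 2 ^ r * n ^ e * (e * k.+1) ^ r * B)%N.
  apply: (@leq_trans (A * e`! * (2 ^ r * n ^_ r))); first by rewrite leq_mul2l nr orbT.
  apply: (@leq_trans (2 ^ r * e`! * ('C(m, e) * (e * k.+1) ^ r * B))).
    have -> : (A * e`! * (2 ^ r * n ^_ r) = 2 ^ r * e`! * (A * n ^_ r))%N by lia.
    by rewrite leq_mul2l AB orbT.
  have : ('C(m, e) * e`! <= n ^ e)%N.
    by apply: leq_trans (leq_bin_fact _ _) _; apply: leq_expl.
  by move=> H; nia.
have c1 : ((2 ^ r * n ^ e * (e * k.+1) ^ r) ^ 2 <= pair_const ^ (2 * r) * r`! * n ^ r * e`! ^ 2)%N.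
  have e2 : ((e * 2) ^ r <= 4 ^ r * r`!)%N.
    by apply: leq_trans (leq_expnn_fact r); apply: leq_expl; rewrite /e; lia.
  have n2 : ((n ^ e) ^ 2 <= n ^ r)%N by rewrite -expnM leq_pexp2l // /e; lia.
  have f2 := leq_fact_half r; rewrite -/e in f2.
  have -> : ((2 ^ r * n ^ e * (e * k.+1) ^ r) ^ 2 = ((e * 2) ^ r) ^ 2 * (k.+1 ^ r) ^ 2 * (n ^ e) ^ 2)%N.
    rewrite !expnMn; lia.
  have -> : (pair_const ^ (2 * r) * r`! * n ^ r * e`! ^ 2 =
     ((4 ^ r) ^ 2 * r`! * (k.+1 ^ r) ^ 2) * (4 ^ r * e`! ^ 2) * n ^ r)%N.
    rewrite /pair_const (mulnC 2%N r) expnM !expnMn.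
    have -> : (8 ^ r = 4 ^ r * 2 ^ r)%N by rewrite -expnMn.
    have -> : (4 ^ r = 2 ^ r * 2 ^ r)%N by rewrite -expnMn.
    by rewrite !expnS !expn0 !muln1; lia.
  apply: leq_mul => //.
  apply: (@leq_trans ((4 ^ r * r`!) ^ 2 * (k.+1 ^ r) ^ 2)).
    by rewrite leq_mul2r leq_exp2r // e2 orbT.
  rewrite expnMn.
  have -> : ((4 ^ r) ^ 2 * r`! ^ 2 * (k.+1 ^ r) ^ 2 = ((4 ^ r) ^ 2 * r`! * (k.+1 ^ r) ^ 2) * r`!)%N.
    by rewrite !expnS !expn0 !muln1; lia.
  by rewrite leq_mul2l f2 orbT.
(* [wgt] is a square root, so squares are compared; clearing denominators leaves an inequality
   between natural numbers. *)
apply: ler_sqr_ge0; first by rewrite !mulr_ge0 ?exprn_ge0 ?wgt_ge0 ?ler0n.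
have -> : (pair_const%:R ^+ r * wgt r * B%:R) ^+ 2 =
    (pair_const%:R ^+ r) ^+ 2 * r`!%:R * B%:R ^+ 2 / n%:R ^+ r.
  by rewrite !exprMn sqr_wgt; move: (_ ^-1) => z; ring.
rewrite ler_pdivlMr ?exprn_gt0 ?ltr0n //.
rewrite -!natrX -!natrM ler_nat.
rewrite -(@leq_pmul2r (e`! ^ 2 * n ^ r)) ?muln_gt0 ?expn_gt0 ?fact_gt0 ?n0 //.
have -> : (A ^ 2 * n ^ r * (e`! ^ 2 * n ^ r) = (A * e`! * n ^ r) ^ 2)%N.
  by rewrite !expnMn [((n ^ r) ^ 2)%N]expnS expn1; lia.
apply: (@leq_trans ((2 ^ r * n ^ e * (e * k.+1) ^ r * B) ^ 2)); first by rewrite leq_exp2r.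
rewrite expnMn.
apply: leq_trans (leq_mul c1 (leqnn _)) _.
by rewrite (mulnC 2%N r) expnM; lia.
Qed.
End Key.

(** * Action of one round on a fixed low frequency *)

Section Key.
Variables (R : rcfType) (q n m k : nat) (Msg : finType).
Local Notation C := (R[i]).
Local Notation V := {ffun 'I_n -> 'Z_q}.
Local Notation W := {ffun 'I_m * 'I_k -> 'Z_q}.
Local Notation pos := ('I_m * 'I_k.+1)%type.
Local Notation MM := {ffun pos -> 'I_n}.
Local Notation inj := [set M : MM | injectiveb M].
Local Notation Q := (#|'Z_q| ^ k)%N.
Local Notation wgt := (@wgt R n).
Implicit Types (M : MM) (u : V) (v : W) (G : W -> Msg).
Hypotheses (n0 : (0 < n)%N) (mn : (m <= n)%N).

Definition pweight (beta : R) h : R := beta ^+ h * wgt h.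
Local Notation pw := pweight.
Lemma pweight_ge0 beta h : 0 <= beta -> 0 <= pw beta h.
Proof. by move=> b0; rewrite mulr_ge0 ?exprn_ge0 ?wgt_ge0. Qed.

Definition restrict_blocks (T : {set 'I_m}) v : W := [ffun p => if p.1 \in T then v p else 0].

Lemma blocks_restrict T v : blocks (restrict_blocks T v) \subset T.
Proof. by apply/blocksP => i l iT; rewrite ffunE (negPf iT). Qed.

(** The part t of v on the edges in T is split off and becomes a shift; the rest is then allowed to
    use any l edges, hence an inequality. *)
Lemma sum_by_restriction (T : {set 'I_m}) (F : W -> R) l : (forall v, 0 <= F v) ->
  \sum_(v | #|blocks v :\: T| == l) F v <=
  \sum_(t | blocks t \subset T) \sum_(v | #|blocks v| == l) F (t + v).
Proof.
move=> F0.
rewrite (partition_big (restrict_blocks T) (fun t => blocks t \subset T)) => [|v _];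
  last exact: blocks_restrict.
apply: ler_sum => t tT; rewrite (reindex_inj (addrI t)) /=.
rewrite big_mkcond [leRHS]big_mkcond /=; apply: ler_sum => v _.
case: ifP => [/andP[/eqP vl /eqP vt]|_]; last by case: ifP.
have vT i l' : i \in T -> v (i, l') = 0.
  move=> iT; have /ffunP/(_ (i, l')) := vt; rewrite !ffunE /= iT.
  by rewrite -[RHS]addr0 => /addrI.
suff -> : blocks v = blocks (t + v) :\: T by rewrite vl eqxx.
apply/setP => i; rewrite !inE; have [iT|iT] /= := boolP (i \in T).
  by apply/existsP => -[l' /eqP[]]; apply: vT.
by apply: eq_existsb => l'; rewrite ffunE (elimT (blocksP t T) tT) // add0r.
Qed.

(** On the edges meeting supp u, v takes at most Q^(wt u) values, each acting as a shift; the rest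
    is graded by its number l of edges. [wt_add_adjoint_ge] gives l <= H' and bounds [wgt], and
    [wt_add_adjoint_le] bounds the power of beta. *)
Lemma sum_shifted_level_le M u G (beta : R) (H' : nat) (cap : nat -> R) :
  injective M -> 1 <= beta ->
  (forall v0 l, (l <= H')%N -> level_mass R G l v0 <= cap l) ->
  \sum_a \sum_(v | (wt (u + adjoint M v)%R <= H')%N)
     nm (fc (ind R G a) v) * pw beta (wt (u + adjoint M v)) <=
  Q%:R ^+ wt u * \sum_(l < H'.+1) cap l *
    (beta ^+ (k.+2 * wt u + k.+1 * l) * wgt (wt u - #|paired_part M u| + 2 * l)).
Proof.
move=> Mi b1 HL; set T := touch M u; set r := #|paired_part M u|.
have b0 : 0 <= beta by apply: le_trans b1.
pose B l := beta ^+ (k.+2 * wt u + k.+1 * l) * wgt (wt u - r + 2 * l).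
have B0 l : 0 <= B l by rewrite mulr_ge0 ?exprn_ge0 ?wgt_ge0.
have Lam0 l : (l <= H')%N -> 0 <= cap l.
  by move=> /(HL 0); apply: le_trans; apply: level_mass_ge0.
pose D a v := nm (fc (ind R G a) v).
have D0 a v : 0 <= D a v by exact: nm_ge0.
apply: (@le_trans _ _ (\sum_a \sum_(l < H'.+1) \sum_(v | #|blocks v :\: T| == l) D a v * B l)).
  apply: ler_sum => a _.
  under [leRHS]eq_bigr => l _ do rewrite big_mkcond /=.
  rewrite exchange_big /= big_mkcond /=; apply: ler_sum => v _.
  case: ifP => [wH|_]; last by apply: sumr_ge0 => l _; case: ifP => // _; rewrite mulr_ge0.
  have ge := wt_add_adjoint_ge Mi u v; have le := wt_add_adjoint_le Mi u v.
  have rh : (r <= wt u)%N by apply: subset_leq_card; apply/subsetP => j; rewrite inE => /andP[].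
  have lH : (#|blocks v :\: T| < H'.+1)%N by move: ge; rewrite -/T -/r; lia.
  rewrite (bigD1 (Ordinal lH)) //= eqxx -[leLHS]addr0 lerD //; last first.
    by apply: sumr_ge0 => l _; case: ifP => // _; rewrite mulr_ge0.
  rewrite /pweight /B ler_wpM2l ?nm_ge0 //= ler_pM ?exprn_ge0 ?wgt_ge0 //.
    by rewrite ler_weXn2l //; move: le; rewrite -/T mulnDr addnA -mulSn.
  apply: wgt_mono => //; apply/andP; split; first by rewrite -(leq_add2r r) addnAC subnK.
  by rewrite -[n in (_ <= n)%N]card_ord wt_le.
apply: (@le_trans _ _ (\sum_a \sum_(l < H'.+1) \sum_(t | blocks t \subset T)
   \sum_(v | #|blocks v| == l) D a (t + v) * B l)).
  apply: ler_sum => a _; apply: ler_sum => l _.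
  by apply: (@sum_by_restriction T (fun v => D a v * B l)) => v; rewrite mulr_ge0.
rewrite exchange_big /= mulr_sumr; apply: ler_sum => l _.
rewrite exchange_big /=.
apply: (@le_trans _ _ (\sum_(t | blocks t \subset T) cap l * B l)).
  apply: ler_sum => t _; under eq_bigr do rewrite -mulr_suml.
  rewrite -mulr_suml ler_wpM2r //; apply: HL; by rewrite -ltnS.
rewrite sumr_const -[leLHS]mulr_natl -/(B l) ler_wpM2r //.
  by rewrite mulr_ge0 ?Lam0 // -ltnS.
have -> : #|[pred t : W | blocks t \subset T]| = (Q ^ #|T|)%N.
  by rewrite -card_blocks_sub cardsE.
rewrite natrX ler_weXn2l ?card_touch // ler1n expn_gt0; apply/orP; left.
by apply/card_gt0P; exists 0.
Qed.

(** The probability that S is the paired part contains the factor wgt #|S|, which by [wgtM] pays for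
    the weight lost on S. In the new base, 4 is a factor 2 for the choice of S inside supp u times a
    factor 2 from [wgtD]. *)
Lemma avg_shifted_level_le (G : MM -> W -> Msg) u (beta : R) (H' : nat) (cap : nat -> R) :
  1 <= beta -> (2 * wt u <= n)%N -> ((wt u)./2 <= m)%N ->
  (forall M v0 l, (l <= H')%N -> level_mass R (G M) l v0 <= cap l) ->
  \sum_(M in inj) \sum_a \sum_(v | (wt (u + adjoint M v)%R <= H')%N)
     nm (fc (ind R (G M) a) v) * pw beta (wt (u + adjoint M v)) <=
  #|inj|%:R * (pw (4 * (pair_const k)%:R * Q%:R * beta ^+ k.+2) (wt u) *
    \sum_(l < H'.+1) cap l * ((2 * beta ^+ k.+1) ^+ l * wgt (2 * l))).
Proof.
move=> b1 un um HL; set h := wt u.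
have b0 : 0 <= beta by apply: le_trans b1.
(* An arbitrary map, taken only to derive 0 <= cap l from the hypothesis on level masses. *)
pose M0 : MM := [ffun=> Ordinal n0].
have Lam0 l : (l <= H')%N -> 0 <= cap l.
  by move=> /(HL M0 0); apply: le_trans; apply: level_mass_ge0.
pose B l r := beta ^+ (k.+2 * h + k.+1 * l) * wgt (h - r + 2 * l).
have B0 l r : 0 <= B l r by rewrite mulr_ge0 ?exprn_ge0 ?wgt_ge0.
apply: (@le_trans _ _ (\sum_(M in inj) Q%:R ^+ h * \sum_(l < H'.+1) cap l * B l #|paired_part M u|)).
  by apply: ler_sum => M; rewrite inE => /injectiveP Mi; apply: sum_shifted_level_le => // v0 l; apply: HL.
rewrite -mulr_sumr exchange_big /= [pw _ _ * _]mulr_sumr [_ * \sum_(i < _) _]mulr_sumr mulr_sumr.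
apply: ler_sum => l _; rewrite -mulr_sumr.
have l0 : 0 <= cap l by rewrite Lam0 // -ltnS.
apply: (@le_trans _ _ (Q%:R ^+ h * (cap l * (#|inj|%:R * (2 ^+ h * ((pair_const k)%:R ^+ h *
    (beta ^+ (k.+2 * h + k.+1 * l) * (2 ^+ (h + l) * (wgt h * wgt (2 * l))))))))));
  last first.
  have e4 : (4 : R) ^+ h = 2 ^+ h * 2 ^+ h by rewrite -exprMn; congr (_ ^+ _); ring.
  rewrite le_eqVlt; apply/orP; left; apply/eqP.
  rewrite /pweight [(_ * beta ^+ k.+2) ^+ h]exprMn [(_ * Q%:R) ^+ h]exprMn [(4 * _) ^+ h]exprMn.
  rewrite [(2 * _) ^+ l]exprMn e4 [beta ^+ (_ + _)]exprD !exprM [2 ^+ (h + l)]exprD.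
  by move: (beta ^+ _ ^+ h) (beta ^+ _ ^+ l) (Q%:R ^+ h) ((pair_const k)%:R ^+ h) => x y z t; ring.
rewrite ler_wpM2l ?exprn_ge0 ?ler0n // ler_wpM2l //.
rewrite (partition_big (fun M => paired_part M u) (fun S => S \in powerset (supp u))) /=; last first.
  by move=> M _; rewrite inE; apply/subsetP => j; rewrite inE => /andP[].
have -> : #|inj|%:R * (2 ^+ h * ((pair_const k)%:R ^+ h *
    (beta ^+ (k.+2 * h + k.+1 * l) * (2 ^+ (h + l) * (wgt h * wgt (2 * l)))))) =
   \sum_(S in powerset (supp u)) #|inj|%:R * ((pair_const k)%:R ^+ h *
    (beta ^+ (k.+2 * h + k.+1 * l) * (2 ^+ (h + l) * (wgt h * wgt (2 * l))))) :> R.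
  by rewrite sumr_const card_powerset -[RHS]mulr_natl natrX mulrCA.
apply: ler_sum => S; rewrite inE => Su.
have Sh : (#|S| <= h)%N by apply: subset_leq_card.
rewrite (eq_bigr (fun=> B l #|S|)) => [|M /andP[_ /eqP-> //]].
rewrite sumr_const -[leLHS]mulr_natl.
have cle : (#|[pred M in inj | paired_part M u == S]| <= #|[set M in inj | paired M S]|)%N.
  apply: subset_leq_card; apply/subsetP => M; rewrite !inE => /andP[-> /eqP <-].
  exact: paired_partP.
apply: (@le_trans _ _ (#|[set M in inj | paired M S]|%:R * B l #|S|)).
  by rewrite ler_wpM2r // ler_nat.
apply: le_trans (ler_wpM2r (B0 _ _) (@prob_paired R n m k n0 mn S _ _)) _.
- apply: leq_trans um; exact: half_leq.
- by apply: leq_trans un; rewrite leq_mul2l.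
rewrite mulrAC mulrC ler_wpM2l ?ler0n // -mulrA.
rewrite ler_pM ?mulr_ge0 ?exprn_ge0 ?ler0n ?wgt_ge0 //.
  by rewrite ler_weXn2l // ler1n /pair_const muln_gt0.
rewrite /B mulrCA ler_wpM2l ?exprn_ge0 //.
apply: le_trans (wgtM _ _ _ _) _.
have -> : (#|S| + (h - #|S| + 2 * l) = h + 2 * l)%N by lia.
exact: wgtD.
Qed.
End Key.

(** * One round *)

Section OneStep.
Variables (R : rcfType) (q n m k : nat) (Msg : finType).
Local Notation C := (R[i]).
Local Notation V := {ffun 'I_n -> 'Z_q}.
Local Notation W := {ffun 'I_m * 'I_k -> 'Z_q}.
Local Notation pos := ('I_m * 'I_k.+1)%type.
Local Notation MM := {ffun pos -> 'I_n}.
Local Notation inj := [set M : MM | injectiveb M].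
Local Notation Q := (#|'Z_q| ^ k)%N.
Local Notation wgt := (@wgt R n).
Local Notation pw := (@pweight R n).
Implicit Types (M : MM) (u s : V) (v : W) (a : Msg).
Hypotheses (n0 : (0 < n)%N) (m0 : (0 < m)%N) (mkn : (4 * (m * k.+1) <= n)%N).

(** The matching covers at most a quarter of the vertices, and passing from the falling factorial to
    n^r loses 2 per vertex, so each vertex of S costs a factor 1/2. A set with more than m (k + 1)
    elements is never covered. *)
Lemma cover_prob (S : {set 'I_n}) :
  (2 ^ #|S| * #|[set M in inj | S \subset codom M]| <= #|inj|)%N.
Proof.
have [rm|rm] := leqP #|S| (m * k.+1); last first.
  rewrite (_ : [set M in inj | _] = set0) ?cards0 ?muln0 //.
  apply/setP => M; rewrite !inE; apply/negbTE/negP => /andP[_ Sc].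
  have := leq_trans (subset_leq_card Sc) (leq_image_card M predT).
  by rewrite cardT /= -cardT card_prod !card_ord leqNgt rm.
have := @card_cover n m k S; set r := #|S|; set A := #|[set M in _ | _]|; set B := #|inj| => AB.
have nr : (n ^ r <= 2 ^ r * n ^_ r)%N by apply: leq_expn_ffact; lia.
have p0 : (0 < (2 * (m * k.+1)) ^ r)%N by rewrite expn_gt0 !muln_gt0 m0.
rewrite -(leq_pmul2l p0).
apply: (@leq_trans (n ^ r * A)).
  by rewrite mulnA -expnMn leq_mul2r leq_expl ?orbT //; lia.
apply: (@leq_trans (2 ^ r * n ^_ r * A)); first by rewrite leq_mul2r nr orbT.
by rewrite expnMn -!mulnA leq_mul2l (mulnC _ A) AB orbT.
Qed.

(** The case u = 0: nothing is paired, so the bound holds for every single matching, and as v is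
    nonzero the sum starts at l = 1. *)
Lemma sum_fresh_level_le M (g : W -> Msg) (beta : R) (H' : nat) (cap : nat -> R) :
  injective M -> 1 <= beta ->
  (forall l, (l <= H')%N -> level_mass R g l 0 <= cap l) ->
  \sum_a \sum_(v : W | (v != 0) && (wt (adjoint M v) <= H')%N)
     nm (fc (ind R g a) v) * pw beta (wt (adjoint M v)) <=
  \sum_(1 <= l < H'.+1) cap l * ((2 * beta ^+ k.+1) ^+ l * wgt (2 * l)).
Proof.
move=> Mi b1 HL.
have b0 : 0 <= beta by apply: le_trans b1.
pose B l := (2 * beta ^+ k.+1) ^+ l * wgt (2 * l).
have B0 l : 0 <= B l by rewrite mulr_ge0 ?wgt_ge0 ?exprn_ge0 ?mulr_ge0 ?exprn_ge0.
pose D a v := nm (fc (ind R g a) v).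
have D0 a v : 0 <= D a v by exact: nm_ge0.
rewrite big_add1 /= big_mkord.
apply: (@le_trans _ _ (\sum_a \sum_(l < H') \sum_(v : W | #|blocks v| == l.+1) D a v * B l.+1)).
  apply: ler_sum => a _.
  under [leRHS]eq_bigr => l _ do rewrite big_mkcond /=.
  rewrite exchange_big /= big_mkcond /=; apply: ler_sum => v _.
  case: ifP => [/andP[v0 wH]|_]; last by apply: sumr_ge0 => l _; case: ifP => // _; rewrite mulr_ge0.
  have T0 : touch M (0 : V) = set0.
    by apply/setP => i; rewrite !inE; apply/existsP => -[c]; rewrite ffunE eqxx.
  have ge := wt_add_adjoint_ge Mi 0 v; have le := wt_add_adjoint_le Mi 0 v.
  rewrite T0 setD0 add0r wt0 add0n in ge le.
  have P0 : #|paired_part M (0 : V)| = 0%N.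
    by apply/eqP; rewrite cards_eq0 -subset0; apply/subsetP => j; rewrite !inE ffunE eqxx.
  rewrite P0 addn0 in ge; rewrite !add0n in le.
  have v1 : (0 < #|blocks v|)%N by rewrite lt0n blocks_eq0.
  have lH : (#|blocks v|.-1 < H')%N by lia.
  rewrite (bigD1 (Ordinal lH)) //= prednK // eqxx -[leLHS]addr0 lerD //; last first.
    by apply: sumr_ge0 => l _; case: ifP => // _; rewrite mulr_ge0.
  rewrite ler_wpM2l ?nm_ge0 // /pweight /B.
  apply: ler_pM; rewrite ?exprn_ge0 ?wgt_ge0 //.
    apply: (@le_trans _ _ ((beta ^+ k.+1) ^+ #|blocks v|)).
      by rewrite -exprM ler_weXn2l.
    rewrite exprMn ler_peMl ?exprn_ge0 //; by rewrite exprn_ege1 // ler1n.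
  by apply: wgt_mono => //; rewrite ge /= -[n in (_ <= n)%N]card_ord wt_le.
rewrite exchange_big /=; apply: ler_sum => l _.
under eq_bigr do rewrite -mulr_suml.
rewrite -mulr_suml -/(B l.+1) ler_wpM2r //.
apply: le_trans (HL l.+1 _) => //.
by rewrite /level_mass; under [leRHS]eq_bigr => a _ do under eq_bigr do rewrite add0r.
Qed.

Variables (G : MM -> W -> Msg -> Msg) (yes_ind : Msg -> V -> C) (c : Msg -> C).
Hypothesis phi1 : forall a x, nm (yes_ind a x) <= 1.
Hypothesis c1 : \sum_a nm (c a) <= 1.

Definition msg_coeff M a' a v : C := fc (ind R (fun w => G M w a') a) v.
(* Difference between the Fourier coefficient of a message in the YES game and its
   probability in the NO game, which only has the zero frequency. *)
Definition bias a' u : C := fc (yes_ind a') u - (if u == 0 then c a' else 0).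
Definition next_bias M a s : C :=
  fc (fun x => \sum_a' yes_ind a' x * (G M (observe M x) a' == a)%:R) s
  - (if s == 0 then \sum_a' c a' * msg_coeff M a' a 0 else 0).

(* The convolution split into low frequencies, high frequencies, and the fresh bias
   created by the message itself from the constant part. *)
Lemma next_biasE M a s H : next_bias M a s = \sum_a' (
   \sum_(v : W | (wt (s - adjoint M v)%R <= H)%N) msg_coeff M a' a v * bias a' (s - adjoint M v) +
   \sum_(v : W | ~~ (wt (s - adjoint M v)%R <= H)%N) msg_coeff M a' a v * fc (yes_ind a') (s - adjoint M v) +
   c a' * \sum_(v : W | (v != 0) && (s == adjoint M v)) msg_coeff M a' a v).
Proof.
rewrite /next_bias fc_sum.
have -> : (if s == 0 then \sum_a' c a' * msg_coeff M a' a 0 else 0) =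
    \sum_a' (if s == 0 then c a' * msg_coeff M a' a 0 else 0) by case: ifP; rewrite ?big1_eq.
rewrite -sumrB; apply: eq_bigr => a' _.
have -> : fc (fun x => yes_ind a' x * (G M (observe M x) a' == a)%:R) s =
    \sum_(v : W) msg_coeff M a' a v * fc (yes_ind a') (s - adjoint M v).
  transitivity (fc (fun x => \sum_(v : W) msg_coeff M a' a v * (yes_ind a' x * chi R (adjoint M v) x)) s).
    apply: eq_fc => x.
    rewrite -[(_ == _)%:R]/(ind R (fun w => G M w a') a (observe M x)) [ind R _ a _]fc_inv mulr_sumr.
    by apply: eq_bigr => v _; rewrite chi_observe mulrCA.
  by rewrite fc_sum; apply: eq_bigr => v _; rewrite fcZ fc_chi_mul.
rewrite (bigID (fun v => (wt (s - adjoint M v)%R <= H)%N)) /=.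
(* The constant part sits at s = A_M^T v, frequency zero and therefore low. Its term v = 0 is the
   one that [next_bias] subtracts. *)
have E v : fc (yes_ind a') (s - adjoint M v) =
    bias a' (s - adjoint M v) + (if s == adjoint M v then c a' else 0).
  by rewrite /bias subr_eq0 subrK.
have -> : \sum_(v : W | (wt (s - adjoint M v)%R <= H)%N)
      msg_coeff M a' a v * fc (yes_ind a') (s - adjoint M v) =
    \sum_(v : W | (wt (s - adjoint M v)%R <= H)%N) msg_coeff M a' a v * bias a' (s - adjoint M v) +
    \sum_(v : W | s == adjoint M v) c a' * msg_coeff M a' a v.
  under eq_bigr do rewrite E mulrDr.
  rewrite big_split /=; congr (_ + _).
  rewrite big_mkcond [RHS]big_mkcond /=; apply: eq_bigr => v _.
  case: eqP => [->|_]; first by rewrite subrr wt0 /= mulrC.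
  by rewrite mulr0; case: ifP.
have -> : \sum_(v : W | s == adjoint M v) c a' * msg_coeff M a' a v =
    (if s == 0 then c a' * msg_coeff M a' a 0 else 0) +
    c a' * \sum_(v : W | (v != 0) && (s == adjoint M v)) msg_coeff M a' a v.
  rewrite mulr_sumr; have [s0|s0] := eqVneq s 0.
    rewrite (bigD1 (0 : W)) /=; last by rewrite adjoint0 s0.
    by congr (_ + _); apply: eq_bigl => v; rewrite andbC s0.
  rewrite add0r; apply: eq_bigl => v; case: (eqVneq v 0) => //= [->].
  by rewrite adjoint0 (negPf s0).
have E4 (x z y h : C) : x + (z + y) + h - z = x + h + y by ring.
exact: E4.
Qed.

Variables (H H' j : nat) (beta : R) (cap : nat -> R) (eps : R).
Hypotheses (b1 : 1 <= beta) (Hn : (2 * H <= n)%N) (Hm : (H./2 <= m)%N).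
Hypothesis HL : forall M a' v0 l, (l <= H')%N -> level_mass R (fun w => G M w a') l v0 <= cap l.
Hypothesis K2 : \sum_(l < H'.+1) cap l * ((2 * beta ^+ k.+1) ^+ l * wgt (2 * l)) <= 2.
Hypothesis Keps : \sum_(1 <= l < H'.+1) cap l * ((2 * beta ^+ k.+1) ^+ l * wgt (2 * l)) <= eps.
Hypotheses (eps0 : 0 <= eps) (HH : (H' + 2 * j <= H)%N).
(** The base of the weights before the round, when beta is the base after it: lowering the base pays
    for the loss in [avg_shifted_level_le]. *)
Definition beta' : R := 4 * (pair_const k)%:R * Q%:R * beta ^+ k.+2.

Lemma beta_ge0 : 0 <= beta. Proof. exact: le_trans b1. Qed.
Lemma pweight_beta_ge0 h : 0 <= pw beta h. Proof. exact: pweight_ge0 beta_ge0. Qed.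
Lemma leq_mn : (m <= n)%N.
Proof. by apply: leq_trans mkn; nia. Qed.

Definition low_part M a s : R := \sum_a' \sum_(v : W | (wt (s - adjoint M v)%R <= H)%N)
  nm (msg_coeff M a' a v) * nm (bias a' (s - adjoint M v)).
Definition high_part M a s : R := \sum_a' nm (\sum_(v : W | ~~ (wt (s - adjoint M v)%R <= H)%N)
  msg_coeff M a' a v * fc (yes_ind a') (s - adjoint M v)).
Definition fresh_part M a s : R := \sum_a' nm (c a') *
  \sum_(v : W | (v != 0) && (s == adjoint M v)) nm (msg_coeff M a' a v).

(** With u = s - A_M^T v as summation variable the old bias does not depend on M, so the average
    over matchings only concerns the inner sum. *)
Lemma low_part_bound :
  \sum_(M in inj) \sum_a \sum_(s : V | (wt s <= H')%N) low_part M a s * pw beta (wt s) <=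
  #|inj|%:R * (2 * \sum_a' \sum_(u : V | (wt u <= H)%N) nm (bias a' u) * pw beta' (wt u)).
Proof.
have E M a s : low_part M a s * pw beta (wt s) =
   \sum_a' \sum_(v : W | (wt (s - adjoint M v)%R <= H)%N)
  nm (bias a' (s - adjoint M v)) * (nm (msg_coeff M a' a v) * pw beta (wt s)).
  rewrite mulr_suml; apply: eq_bigr => a' _; rewrite mulr_suml; apply: eq_bigr => v _.
  by rewrite mulrA [nm (msg_coeff _ _ _ _) * _]mulrC.
have E2 M a a' : \sum_(s : V | (wt s <= H')%N) \sum_(v : W | (wt (s - adjoint M v)%R <= H)%N)
    nm (bias a' (s - adjoint M v)) * (nm (msg_coeff M a' a v) * pw beta (wt s)) =
  \sum_(u : V | (wt u <= H)%N) nm (bias a' u) * \sum_(v : W | (wt (u + adjoint M v)%R <= H')%N)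
    nm (msg_coeff M a' a v) * pw beta (wt (u + adjoint M v)).
  under [RHS]eq_bigr do rewrite mulr_sumr big_mkcond.
  rewrite [RHS]exchange_big /= big_mkcond /=.
  transitivity (\sum_(s : V) \sum_(v : W) (if (wt s <= H')%N && (wt (s - adjoint M v)%R <= H)%N then
     nm (bias a' (s - adjoint M v)) * (nm (msg_coeff M a' a v) * pw beta (wt s)) else 0)).
    apply: eq_bigr => s _; case: ifP => _ /=; first by rewrite big_mkcond.
    by rewrite big1.
  rewrite exchange_big /=; apply: eq_bigr => v _.
  rewrite (reindex_inj (addIr (adjoint M v))) /= [RHS]big_mkcond /=; apply: eq_bigr => u _.
  by rewrite addrK andbC; case: (wt u <= H)%N.
have -> : \sum_(M in inj) \sum_a \sum_(s : V | (wt s <= H')%N) low_part M a s * pw beta (wt s) =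
  \sum_a' \sum_(u : V | (wt u <= H)%N) nm (bias a' u) * \sum_(M in inj) \sum_a
     \sum_(v : W | (wt (u + adjoint M v)%R <= H')%N) nm (msg_coeff M a' a v) * pw beta (wt (u + adjoint M v)).
  transitivity (\sum_(M in inj) \sum_a' \sum_a \sum_(u : V | (wt u <= H)%N)
    nm (bias a' u) * \sum_(v : W | (wt (u + adjoint M v)%R <= H')%N)
    nm (msg_coeff M a' a v) * pw beta (wt (u + adjoint M v))).
    apply: eq_bigr => M _; rewrite [RHS]exchange_big /=; apply: eq_bigr => a _.
    under eq_bigr do rewrite E.
    by rewrite exchange_big /=; apply: eq_bigr => a' _; rewrite E2.
  rewrite exchange_big /=; apply: eq_bigr => a' _.
  under eq_bigr do rewrite exchange_big /=.
  rewrite exchange_big /=; apply: eq_bigr => u _.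
  by rewrite [RHS]mulr_sumr; apply: eq_bigr => M _; rewrite [RHS]mulr_sumr.
rewrite !mulr_sumr; apply: ler_sum => a' _; rewrite !mulr_sumr; apply: ler_sum => u uH.
have uw : 0 <= pw beta' (wt u).
  by apply: pweight_ge0; rewrite /beta' -!natrM mulr_ge0 ?exprn_ge0 ?beta_ge0 ?ler0n.
rewrite [leRHS](_ : _ = nm (bias a' u) * (#|inj|%:R * (pw beta' (wt u) * 2))); last by ring.
rewrite ler_wpM2l ?nm_ge0 //.
apply: le_trans
  (@avg_shifted_level_le R q n m k Msg n0 leq_mn (fun M w => G M w a') u beta H' cap b1 _ _ _) _.
- by apply: leq_trans Hn; rewrite leq_mul2l.
- by apply: leq_trans Hm; apply: half_leq.
- by move=> M v0 l; apply: HL.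
by rewrite ler_wpM2l ?ler0n // ler_wpM2l.
Qed.

Lemma fresh_part_bound M : injective M ->
  \sum_a \sum_(s : V | (wt s <= H')%N) fresh_part M a s * pw beta (wt s) <= eps.
Proof.
move=> Mi.
apply: (@le_trans _ _ (\sum_a' nm (c a') * eps)); last first.
  by rewrite -mulr_suml ler_piMl.
have -> : \sum_a \sum_(s : V | (wt s <= H')%N) fresh_part M a s * pw beta (wt s) =
   \sum_a' nm (c a') * \sum_a \sum_(v : W | (v != 0) && (wt (adjoint M v) <= H')%N)
     nm (msg_coeff M a' a v) * pw beta (wt (adjoint M v)).
  transitivity (\sum_a \sum_a' nm (c a') * \sum_(v : W | (v != 0) && (wt (adjoint M v) <= H')%N)
     nm (msg_coeff M a' a v) * pw beta (wt (adjoint M v))); last first.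
    by rewrite exchange_big /=; apply: eq_bigr => a' _; rewrite [RHS]mulr_sumr.
  apply: eq_bigr => a _; under eq_bigr do rewrite mulr_suml.
  rewrite exchange_big /=; apply: eq_bigr => a' _.
  under eq_bigr do rewrite -mulrA mulr_suml big_mkcond /=.
  rewrite -mulr_sumr exchange_big /=; congr (_ * _).
  rewrite [RHS]big_mkcond /=; apply: eq_bigr => v _.
  case: eqP => [_|vn0] /=; first by rewrite big1.
  rewrite -big_mkcondr /=; case: ifP => vH.
    rewrite (big_pred1 (adjoint M v)) // => s /=.
    by case: (eqVneq s (adjoint M v)) => [->|]; rewrite ?vH ?andbF.
  rewrite big1 // => s /andP[sH /eqP e].
  by rewrite -e sH in vH.
apply: ler_sum => a' _; rewrite ler_wpM2l ?nm_ge0 //.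
apply: le_trans Keps; apply: sum_fresh_level_le => // l; exact: HL.
Qed.

(** Cauchy-Schwarz with a free parameter; being linear in the sums of squares, it can be averaged
    over matchings. *)
Lemma amgm_sum (th : R) (X : finType) (P : pred X) (f g : X -> C) : 0 < th ->
  2 * nm (\sum_(x | P x) f x * g x) <=
  th * \sum_(x | P x) nm (f x) ^+ 2 + th^-1 * \sum_(x | P x) nm (g x) ^+ 2.
Proof.
move=> th0; rewrite !mulr_sumr -big_split /=.
apply: le_trans (ler_wpM2l _ (nm_sum _ _)) _; first exact: ler0n.
rewrite mulr_sumr; apply: ler_sum => x _; rewrite nmM -subr_ge0.
have -> : th * nm (f x) ^+ 2 + th^-1 * nm (g x) ^+ 2 - 2 * (nm (f x) * nm (g x)) =
   th^-1 * (th * nm (f x) - nm (g x)) ^+ 2.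
  by field; rewrite gt_eqF.
by rewrite mulr_ge0 ?sqr_ge0 // invr_ge0 ltW.
Qed.

(** For given M, the frequency u = s - A_M^T v determines v, and M covers supp (s - u), which has
    more than H - H' >= 2 j elements. [cover_prob] and Parseval conclude. *)
Lemma sum_high_sq a' s : (wt s <= H')%N ->
  \sum_(M in inj) \sum_(v : W | ~~ (wt (s - adjoint M v)%R <= H)%N)
     nm (fc (yes_ind a') (s - adjoint M v)) ^+ 2 <= #|inj|%:R / 2 ^+ (2 * j).
Proof.
move=> sH.
apply: (@le_trans _ _ (\sum_(u : V | ~~ (wt u <= H)%N) nm (fc (yes_ind a') u) ^+ 2 *
    #|[set M in inj | supp (s - u) \subset codom M]|%:R)).
  apply: (@le_trans _ _ (\sum_(M in inj) \sum_(u : V | ~~ (wt u <= H)%N)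
     (if supp (s - u) \subset codom M then nm (fc (yes_ind a') u) ^+ 2 else 0))).
    apply: ler_sum => M; rewrite inE => /injectiveP Mi.
    rewrite (partition_big (fun v => s - adjoint M v) (fun u => ~~ (wt u <= H)%N)) //=.
    apply: ler_sum => u uH.
    case: (pickP (fun v => s - adjoint M v == u)) => [v0 /eqP v0u|no]; last first.
      rewrite big_pred0 => [|v]; last by rewrite no andbF.
      by case: ifP => // _; rewrite exprn_ge0 ?nm_ge0.
    rewrite (big_pred1 v0) => [|v]; last first.
      rewrite /= -v0u; apply/andP/eqP => [[_ /eqP/addrI/oppr_inj/(adjoint_inj Mi)] //|->].
      by rewrite v0u eqxx.
    have -> : s - u = adjoint M v0 by rewrite -v0u subKr.
    rewrite v0u.
    by rewrite (introT subsetP (@supp_adjoint_codom q n m k M v0)).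
  rewrite exchange_big /=; apply: ler_sum => u _.
  rewrite -big_mkcondr sumr_const -[leLHS]mulr_natr ler_wpM2l ?exprn_ge0 ?nm_ge0 // ler_nat.
  apply: subset_leq_card; apply/subsetP => M; by rewrite unfold_in !inE.
have S1 := sum_nm_fc_le1 (phi1 a').
apply: (@le_trans _ _ (\sum_(u : V | ~~ (wt u <= H)%N) nm (fc (yes_ind a') u) ^+ 2 *
    (#|inj|%:R / 2 ^+ (2 * j)))).
  apply: ler_sum => u uH; rewrite ler_wpM2l ?exprn_ge0 ?nm_ge0 //.
  rewrite ler_pdivlMr ?exprn_gt0 // -natrX -natrM ler_nat.
  apply: leq_trans (cover_prob (supp (s - u))); rewrite mulnC leq_mul2r.
  apply/orP; right; rewrite leq_exp2l // -/(wt _).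
  have : (wt u <= wt (s - u)%R + wt s)%N.
    rewrite -(wtN (s - u)) opprB; apply: leq_trans (wtD _ _).
    by rewrite subrK.
  move: uH sH HH; rewrite -ltnNge /wt. move: #|supp u| #|supp s| #|supp (s - u)| => x y z; lia.
rewrite -mulr_suml ler_piMl ?mulr_ge0 ?invr_ge0 ?exprn_ge0 ?ler0n //.
apply: le_trans S1; rewrite [leLHS]big_mkcond /=; apply: ler_sum => u _.
by case: ifP => // _; rewrite exprn_ge0 ?nm_ge0.
Qed.

Lemma high_part_bound :
  \sum_(M in inj) \sum_a \sum_(s : V | (wt s <= H')%N) high_part M a s * pw beta (wt s) <=
  #|inj|%:R * ((#|Msg| ^ 2 * #|[set s : V | (wt s <= H')%N]|)%:R * beta ^+ H' / 2 ^+ j).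
Proof.
have hb a a' s : (wt s <= H')%N -> \sum_(M in inj) nm (\sum_(v : W | ~~ (wt (s - adjoint M v)%R <= H)%N)
  msg_coeff M a' a v * fc (yes_ind a') (s - adjoint M v)) <= #|inj|%:R / 2 ^+ j.
  (* This value balances th against the second term, th^-1 times 2^(-2 j). *)
  move=> sH; set th : R := (2 ^+ j)^-1.
  have th0 : 0 < th by rewrite invr_gt0 exprn_gt0.
  rewrite -(@ler_pM2l _ 2) // mulr_sumr.
  apply: (@le_trans _ _ (\sum_(M in inj) (th + th^-1 *
     \sum_(v : W | ~~ (wt (s - adjoint M v)%R <= H)%N) nm (fc (yes_ind a') (s - adjoint M v)) ^+ 2))).
    apply: ler_sum => M _; apply: le_trans (amgm_sum _ _ _ th0) _.
    rewrite lerD2r ler_piMr ?(ltW th0) //.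
    have i1 : forall w, nm (ind R (fun w => G M w a') a w) <= 1.
      by move=> w; rewrite /ind nm_nat lern1 leq_b1.
    apply: le_trans (sum_nm_fc_le1 i1); rewrite big_mkcond /=.
    by apply: ler_sum => v _; case: ifP => // _; rewrite exprn_ge0 ?nm_ge0.
  rewrite big_split /= sumr_const -mulr_sumr -[X in X + _ <= _]mulr_natl.
  rewrite mulr2n mulrDl mul1r lerD2l.
  apply: le_trans (ler_wpM2l _ (sum_high_sq a' sH)) _; first by rewrite invr_ge0 ltW.
  by rewrite invrK mul2n -addnn exprD invfM mulrCA mulVKf ?expf_neq0 ?pnatr_eq0.
apply: (@le_trans _ _ (\sum_(a : Msg) \sum_(s : V | (wt s <= H')%N) \sum_(a' : Msg)
   #|inj|%:R / 2 ^+ j * beta ^+ H')).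
  rewrite exchange_big /=; apply: ler_sum => a _.
  rewrite exchange_big /=; apply: ler_sum => s sH.
  rewrite -mulr_suml /high_part exchange_big /= mulr_suml; apply: ler_sum => a' _.
  apply: ler_pM; rewrite ?pweight_beta_ge0 ?sumr_ge0 //.
  - by move=> M _; exact: nm_ge0.
  - exact: hb.
  have sn : (wt s <= n)%N by rewrite -[n in (_ <= n)%N]card_ord wt_le.
  rewrite -[leRHS]mulr1 ler_pM ?exprn_ge0 ?beta_ge0 ?wgt_ge0 ?wgt_le1 //.
  by rewrite ler_weXn2l.
have cM (x : R) : \sum_(a : Msg) x = #|Msg|%:R * x by rewrite sumr_const mulr_natl.
have cS (x : R) : \sum_(s : V | (wt s <= H')%N) x = #|[set s : V | (wt s <= H')%N]|%:R * x.
  by rewrite sumr_const cardsE mulr_natl.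
rewrite cM cS cM natrM natrX le_eqVlt; apply/orP; left; apply/eqP.
have E5 (d c2 b z t : R) : d * (c2 * (d * (t * z * b))) = t * (d ^+ 2 * c2 * b * z) by ring.
exact: E5.
Qed.

Lemma bias_step :
  \sum_(M in inj) \sum_a \sum_(s : V | (wt s <= H')%N) nm (next_bias M a s) * pw beta (wt s) <=
  #|inj|%:R * (2 * (\sum_a' \sum_(u : V | (wt u <= H)%N) nm (bias a' u) * pw beta' (wt u)) +
   eps + (#|Msg| ^ 2 * #|[set s : V | (wt s <= H')%N]|)%:R * beta ^+ H' / 2 ^+ j).
Proof.
rewrite !mulrDr; apply: le_trans (lerD (lerD low_part_bound _) high_part_bound); last first.
  apply: (@le_trans _ _ (\sum_(M in inj) eps)).
    by apply: ler_sum => M; rewrite inE => /injectiveP /fresh_part_bound; apply.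
  by rewrite sumr_const mulr_natl.
rewrite -!big_split /=; apply: ler_sum => M _.
rewrite -!big_split /=; apply: ler_sum => a _.
rewrite -!big_split /=; apply: ler_sum => s _.
rewrite -!mulrDl ler_wpM2r ?pweight_beta_ge0 // (next_biasE _ _ _ H).
apply: le_trans (nm_sum _ _) _.
rewrite /low_part /high_part /fresh_part -!big_split /=; apply: ler_sum => a' _.
apply: le_trans (nmD _ _) _; rewrite addrAC lerD //; last first.
  by rewrite nmM ler_wpM2l ?nm_ge0 ?nm_sum.
apply: le_trans (nmD _ _) _; rewrite lerD2r.
by apply: le_trans (nm_sum _ _) _; apply: ler_sum => v _; rewrite nmM.
Qed.
End OneStep.

(** * Iterating over the players *)

Section Resample.
Variables (X : finType) (D : {set X}) (T : nat) (A : nmodType).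
Local Notation XT := {ffun 'I_T -> X}.

Definition upd (f : XT) i x : XT := [ffun t => if t == i then x else f t].

(* A coordinate that F does not see in its first argument can be redrawn. *)
Lemma resample (i : 'I_T) (F : XT -> X -> A) :
  (forall f x y, F (upd f i x) y = F f y) ->
  (\sum_(f : XT | [forall t, f t \in D]) F f (f i)) *+ #|D| =
  \sum_(f : XT | [forall t, f t \in D]) \sum_(x in D) F f x.
Proof.
move=> Fi.
pose h (p : XT * X) := (upd p.1 i p.2, p.1 i).
have hK : involutive h.
  case=> f x; rewrite /h /=; congr (_, _); last by rewrite ffunE eqxx.
  by apply/ffunP => t; rewrite !ffunE; case: eqP => // ->.
rewrite [RHS]pair_big_dep /= (reindex_inj (inv_inj hK)) /=.
under [RHS]eq_bigr do rewrite Fi.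
rewrite -sumrMnl.
rewrite (eq_bigr (fun f : XT => \sum_(x in D) F f (f i))); last by move=> f _; rewrite sumr_const.
rewrite pair_big_dep /=; apply: eq_bigl => -[f x] /=.
apply/andP/andP => -[/forallP fD xD]; split => //.
- by apply/forallP => t; rewrite ffunE; case: ifP.
- apply/forallP => t; have := fD t; rewrite ffunE; case: eqP => // -> _; exact: xD.
- by have := fD i; rewrite ffunE eqxx.
Qed.
End Resample.

Section Multi.
Variables (R : rcfType) (q n m k T : nat) (Msg : finType).
Local Notation C := (R[i]).
Local Notation V := {ffun 'I_n -> 'Z_q}.
Local Notation W := {ffun 'I_m * 'I_k -> 'Z_q}.
Local Notation pos := ('I_m * 'I_k.+1)%type.
Local Notation MM := {ffun pos -> 'I_n}.
Local Notation inj := [set M : MM | injectiveb M].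
Local Notation Q := (#|'Z_q| ^ k)%N.
Local Notation wgt := (@wgt R n).
Local Notation pw := (@pweight R n).
Local Notation MT := {ffun 'I_T -> MM}.
Implicit Types (M : MM) (u s x : V) (v : W) (a : Msg) (Ms : MT).
Hypotheses (n0 : (0 < n)%N) (m0 : (0 < m)%N) (mkn : (4 * (m * k.+1) <= n)%N).
Variables (step : nat -> MM -> W -> Msg -> Msg) (a0 : Msg).

(** Filler for the indices from T on. *)
Definition M0 : MM := [ffun=> Ordinal n0].
Definition mext Ms t : MM := nth_input M0 Ms t.
Definition wext (ws : 'I_T -> W) t : W := nth_input 0 ws t.

Fixpoint state (A : nat -> MM) (w : nat -> W) (t : nat) : Msg :=
  if t is t'.+1 then step t' (A t') (w t') (state A w t') else a0.

Definition yes_ind t Ms a x : C :=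
  (state (mext Ms) (fun i => observe (mext Ms i) x) t == a)%:R.

Definition msg_prob t M a' a : C := msg_coeff R (step t) M a' a 0.

(** The zero coefficient of a message indicator is its probability under uniform labels, so this is
    the distribution of the state in the NO game for given matchings; see [no_prob_count]. *)
Fixpoint no_prob t Ms a : C :=
  if t is t'.+1 then \sum_a' no_prob t' Ms a' * msg_prob t' (mext Ms t') a' a
  else (a0 == a)%:R.

Lemma nth_input_ord (X : Type) (d : X) (f : 'I_T -> X) (i : 'I_T) : nth_input d f i = f i.
Proof. by rewrite /nth_input valK. Qed.

Lemma nth_input_upd (X : finType) (d : X) (f : {ffun 'I_T -> X}) (i : 'I_T) z t : (t < i)%N ->
  nth_input d (upd f i z) t = nth_input d f t.
Proof.
move=> ti; rewrite /nth_input; case: insubP => // j _ jt; rewrite ffunE; case: eqP => // ji.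
by move: ti; rewrite -jt ji ltnn.
Qed.

Lemma eq_state A A' w w' t : (forall i, (i < t)%N -> A i = A' i) ->
  (forall i, (i < t)%N -> w i = w' i) -> state A w t = state A' w' t.
Proof.
elim: t => //= t IH AA ww; rewrite AA // ww // IH // => i it; [apply: AA | apply: ww]; exact: ltnW.
Qed.

Lemma yes_ind_upd Ms (i : 'I_T) M a x : yes_ind i (upd Ms i M) a x = yes_ind i Ms a x.
Proof.
rewrite /yes_ind (@eq_state _ (mext Ms) _ (fun t => observe (mext Ms t) x)) // => t ti;
  by rewrite /mext nth_input_upd.
Qed.
Lemma no_prob_upd Ms (i : 'I_T) M a t : (t <= i)%N -> no_prob t (upd Ms i M) a = no_prob t Ms a.
Proof.
elim: t a => //= t IH a ti; apply: eq_bigr => a' _; rewrite IH ?(ltnW ti) //.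
by rewrite /mext nth_input_upd.
Qed.

Lemma sum_no_prob_le1 t Ms : \sum_a nm (no_prob t Ms a) <= 1.
Proof.
elim: t => [|t IH] /=.
  rewrite (bigD1 a0) //= eqxx nm1 big1 ?addr0 // => a /negPf; rewrite eq_sym => ->.
  exact: nm0.
apply: (@le_trans _ _ (\sum_a \sum_a' nm (no_prob t Ms a') * nm (msg_prob t (mext Ms t) a' a))).
  by apply: ler_sum => a _; apply: le_trans (nm_sum _ _) _; apply: ler_sum => a' _; rewrite nmM.
rewrite exchange_big /=; apply: le_trans IH; apply: ler_sum => a' _.
by rewrite -mulr_sumr ler_piMr ?nm_ge0 // sum_ind_nm_le1.
Qed.

Definition valid Ms := [forall t, Ms t \in inj].

Definition total_bias t H beta : R :=
  \sum_(Ms | valid Ms) \sum_a \sum_(u : V | (wt u <= H)%N)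
    nm (bias (yes_ind t Ms) (no_prob t Ms) a u) * pw beta (wt u).

Lemma total_bias0 H beta : total_bias 0 H beta = 0.
Proof.
apply: big1 => Ms _; apply: big1 => a _; apply: big1 => u _.
by rewrite /bias /yes_ind /= fc_const subrr nm0 mul0r.
Qed.

Lemma yes_ind_succ t Ms a x : yes_ind t.+1 Ms a x =
  \sum_a' yes_ind t Ms a' x * (step t (mext Ms t) (observe (mext Ms t) x) a' == a)%:R.
Proof.
rewrite /yes_ind /=; set b := state _ _ t.
rewrite (bigD1 b) //= eqxx mul1r big1 ?addr0 // => a' /negPf.
by rewrite eq_sym => ->; rewrite mul0r.
Qed.

(** Neither [yes_ind t] nor [no_prob t] sees the matching of round t, so it can be redrawn by
    [resample]; [bias_step] then applies to a fresh uniform matching. *)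
Lemma total_bias_step (t : 'I_T) (H H' j : nat) (beta : R) (cap : nat -> R) (eps : R) :
  1 <= beta -> (2 * H <= n)%N -> (H./2 <= m)%N ->
  (forall (g : W -> Msg) v0 l, (l <= H')%N -> level_mass R g l v0 <= cap l) ->
  \sum_(l < H'.+1) cap l * ((2 * beta ^+ k.+1) ^+ l * wgt (2 * l)) <= 2 ->
  \sum_(1 <= l < H'.+1) cap l * ((2 * beta ^+ k.+1) ^+ l * wgt (2 * l)) <= eps ->
  0 <= eps -> (H' + 2 * j <= H)%N ->
  total_bias t.+1 H' beta <= 2 * total_bias t H (beta' q k beta) + #|valid|%:R * (eps +
    (#|Msg| ^ 2 * #|[set s : V | (wt s <= H')%N]|)%:R * beta ^+ H' / 2 ^+ j).
Proof.
move=> b1 Hn Hm HL K2 Ke e0 HH.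
set eta := eps + _.
pose F Ms M : R := \sum_a \sum_(s : V | (wt s <= H')%N)
  nm (next_bias (step t) (yes_ind t Ms) (no_prob t Ms) M a s) * pw beta (wt s).
have PF : total_bias t.+1 H' beta = \sum_(Ms | valid Ms) F Ms (Ms t).
  apply: eq_bigr => Ms _; apply: eq_bigr => a _; apply: eq_bigr => u _.
  rewrite /bias /next_bias /= -[in Ms t](nth_input_ord M0 Ms t) -/(mext Ms t).
  by congr (nm (_ - _) * _); apply: eq_fc => x; rewrite yes_ind_succ.
have Fup Ms M M' : F (upd Ms t M) M' = F Ms M'.
  apply: eq_bigr => a _; apply: eq_bigr => s _; congr (nm _ * _).
  rewrite /next_bias; congr (_ - _).
    by apply: eq_fc => x; apply: eq_bigr => a' _; rewrite yes_ind_upd.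
  by case: ifP => // _; apply: eq_bigr => a' _; rewrite no_prob_upd.
have i0 : (0 < #|inj|%:R :> R).
  rewrite ltr0n card_inj_ffuns card_prod !card_ord ffact_gt0.
  by apply: leq_trans mkn; rewrite leq_pmull.
rewrite -(ler_pM2r i0) PF mulr_natr (@resample _ inj _ _ t F Fup).
have -> : (2 * total_bias t H (beta' q k beta) + #|valid|%:R * eta) * #|inj|%:R =
   \sum_(Ms | valid Ms) #|inj|%:R * (2 * (\sum_a \sum_(u : V | (wt u <= H)%N)
    nm (bias (yes_ind t Ms) (no_prob t Ms) a u) * pw (beta' q k beta) (wt u)) + eta).
  by rewrite -mulr_sumr big_split /= -mulr_sumr sumr_const [#|valid|%:R * _]mulr_natl mulrC.
apply: ler_sum => Ms _; rewrite /eta addrA; apply: bias_step => //.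
- move=> a x; rewrite /yes_ind nm_nat lern1; exact: leq_b1.
- exact: sum_no_prob_le1.
- by move=> M a' v0 l; apply: HL.
- exact: K2.
- exact: Ke.
Qed.

Lemma total_bias_iter (Hs : nat -> nat) (betas : nat -> R) (e : R) : 0 <= e ->
  (forall t : 'I_T, total_bias t.+1 (Hs t.+1) (betas t.+1) <=
     2 * total_bias t (Hs t) (betas t) + #|valid|%:R * e) ->
  total_bias T (Hs T) (betas T) <= 2 ^+ T * (#|valid|%:R * e).
Proof.
move=> e0 step_le; set X := #|valid|%:R * e; have X0 : 0 <= X by rewrite mulr_ge0 ?ler0n.
have H t : (t <= T)%N -> total_bias t (Hs t) (betas t) <= (2 ^+ t - 1) * X.
  elim: t => [_|t IH tT]; first by rewrite total_bias0 expr0 subrr mul0r.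
  apply: le_trans (step_le (Ordinal tT)) _ => /=; rewrite -/X.
  apply: le_trans (lerD (ler_wpM2l _ (IH (ltnW tT))) (lexx _)) _ => //.
  by rewrite exprS le_eqVlt; apply/orP; left; apply/eqP; ring.
apply: le_trans (H T (leqnn T)) _.
by rewrite ler_wpM2r // gerBl.
Qed.

Local Notation WT := {ffun 'I_T -> W}.

Lemma wext_upd (ws : WT) (i : 'I_T) w t : (t < i)%N -> wext (upd ws i w) t = wext ws t.
Proof. exact: nth_input_upd. Qed.

Lemma no_prob_count Ms t a : (t <= T)%N ->
  \sum_(ws : WT) (state (mext Ms) (wext ws) t == a)%:R = #|{: WT}|%:R * no_prob t Ms a.
Proof.
elim: t a => [|t IH] a tT /=; first by rewrite sumr_const mulr_natl.
pose i := Ordinal tT.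
pose F a' (ws : WT) (w : W) : C :=
  (state (mext Ms) (wext ws) t == a')%:R * (step t (mext Ms t) w a' == a)%:R.
have FU a' (ws : WT) (w w' : W) : F a' (upd ws i w) w' = F a' ws w'.
  by rewrite /F (@eq_state _ (mext Ms) _ (wext ws)) // => t' tt'; rewrite wext_upd.
have W0 : (#|{: W}|%:R : C) != 0 by exact: cV_neq0.
apply: (mulIf W0).
have gE a' : #|{: W}|%:R * msg_prob t (mext Ms t) a' a = \sum_w (step t (mext Ms t) w a' == a)%:R.
  rewrite /msg_prob /msg_coeff /fc mulVKf //; apply: eq_bigr => w _.
  by rewrite oppr0 chi0 mulr1.
have RS a' : (\sum_(ws : WT) F a' ws (ws i)) * #|{: W}|%:R =
    #|{: WT}|%:R * no_prob t Ms a' * (#|{: W}|%:R * msg_prob t (mext Ms t) a' a).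
  have := @resample _ [set: W] T _ i (F a') (FU a').
  have vT (f : WT) : [forall j, f j \in [set: W]] by apply/forallP => j; rewrite inE.
  rewrite (eq_bigl predT) => [|f]; last by rewrite vT.
  rewrite [in RHS](eq_bigl predT) => [|f]; last by rewrite vT.
  rewrite cardsT mulr_natr => ->.
  rewrite -IH ?(ltnW tT) // gE mulr_suml; apply: eq_bigr => ws _.
  by rewrite mulr_sumr; apply: eq_big => // w; rewrite inE.
transitivity ((\sum_a' \sum_(ws : WT) F a' ws (ws i)) * #|{: W}|%:R).
  congr (_ * _); rewrite exchange_big /=; apply: eq_bigr => ws _.
  rewrite (bigD1 (state (mext Ms) (wext ws) t)) //= /F eqxx mul1r big1 ?addr0.
    by rewrite /wext -[t in nth_input _ _ t]/(val i) nth_input_ord.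
  by move=> a' /negPf; rewrite eq_sym => ->; rewrite mul0r.
rewrite mulr_suml mulr_sumr mulr_suml; apply: eq_bigr => a' _.
by rewrite RS; ring.
Qed.

(** At threshold 0 only the zero frequency is left, and its bias at [acc] is the difference of the
    acceptance probabilities for given matchings; the other states only add nonnegative terms. *)
Lemma advantage_bound (beta : R) (acc : Msg) :
  `| (#|{: V}|%:R)^-1 * \sum_(Ms | valid Ms) \sum_x
        (state (mext Ms) (fun i => observe (mext Ms i) x) T == acc)%:R -
     (#|{: WT}|%:R)^-1 * \sum_(Ms | valid Ms) \sum_(ws : WT)
        (state (mext Ms) (wext ws) T == acc)%:R | <= total_bias T 0 beta.
Proof.
rewrite -nm_real.
have -> : ((#|{: V}|%:R)^-1 * \sum_(Ms | valid Ms) \sum_x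
        (state (mext Ms) (fun i => observe (mext Ms i) x) T == acc)%:R -
     (#|{: WT}|%:R)^-1 * \sum_(Ms | valid Ms) \sum_(ws : WT)
        (state (mext Ms) (wext ws) T == acc)%:R)%:C%C =
   \sum_(Ms | valid Ms) bias (yes_ind T Ms) (no_prob T Ms) acc 0.
  rewrite rmorphB !rmorphM !fmorphV !rmorph_nat !rmorph_sum !mulr_sumr -sumrB.
  apply: eq_bigr => Ms _; rewrite !rmorph_sum /bias eqxx; congr (_ - _).
    rewrite /fc; congr (_ * _); apply: eq_bigr => x _.
    by rewrite oppr0 chi0 mulr1 rmorph_nat.
  have WT0 : (#|{: WT}|%:R : C) != 0.
    by rewrite pnatr_eq0 -lt0n; apply/card_gt0P; exists [ffun=> 0].
  rewrite (eq_bigr (fun ws : WT => (state (mext Ms) (wext ws) T == acc)%:R)) => [|ws _].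
    by rewrite no_prob_count // mulKf.
  by rewrite rmorph_nat.
apply: le_trans (nm_sum _ _) _; apply: ler_sum => Ms _.
rewrite (bigD1 acc) //= -[leLHS]addr0; apply: lerD.
  by rewrite (big_pred1 (0 : V)) => [|u]; rewrite ?leqn0 ?wt_eq0 // wt0 /pweight expr0 mul1r wgt0 mulr1.
apply: sumr_ge0 => a _; apply: sumr_ge0 => u; rewrite leqn0 wt_eq0 => /eqP->.
by rewrite wt0 mulr_ge0 ?nm_ge0 // /pweight expr0 mul1r wgt_ge0.
Qed.
End Multi.

Lemma sum_geom (R : realFieldType) (x : R) h : 0 <= x -> 2 * x <= 1 ->
  \sum_(1 <= l < h.+1) x ^+ l <= 2 * x.
Proof.
move=> x0 x1.
have H : (1 - x) * \sum_(1 <= l < h.+1) x ^+ l = x - x ^+ h.+1.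
  elim: h => [|h IH]; first by rewrite big_nil mulr0 expr1 subrr.
  by rewrite big_nat_recr //= mulrDr IH [x ^+ h.+2]exprS; ring.
set S := \sum_(1 <= l < h.+1) x ^+ l in H *.
have S0 : 0 <= S by apply: sumr_ge0 => l _; rewrite exprn_ge0.
have xh : 0 <= x ^+ h.+1 by rewrite exprn_ge0.
by nra.
Qed.

(** Indexed by the rounds still to be played: the base is 1 at the end and [beta'] is applied once
    per round backwards. *)
Fixpoint beta_seq (q k j : nat) : nat :=
  if j is j'.+1 then (4 * pair_const k * #|'Z_q| ^ k * beta_seq q k j' ^ k.+2)%N else 1%N.

(** * Choice of the thresholds and of the weights *)

Section Params.
Variables (q k : nat).
Local Notation Q := (#|'Z_q| ^ k)%N.
Local Notation beta_seq := (beta_seq q k).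

Lemma card_Zq_gt0 : (0 < #|'Z_q|)%N. Proof. by apply/card_gt0P; exists 0. Qed.
Lemma pair_const_gt0 : (0 < pair_const k)%N. Proof. by rewrite muln_gt0. Qed.
Lemma beta_seq_gt0 j : (0 < beta_seq j)%N.
Proof.
elim: j => //= j IH.
by rewrite muln_gt0 expn_gt0 IH muln_gt0 expn_gt0 card_Zq_gt0 muln_gt0 pair_const_gt0.
Qed.
Lemma beta_seq_mono i j : (i <= j)%N -> (beta_seq i <= beta_seq j)%N.
Proof.
have H d : (beta_seq d <= beta_seq d.+1)%N.
  by rewrite /= expnS mulnCA leq_pmulr // muln_gt0 expn_gt0 beta_seq_gt0
    muln_gt0 expn_gt0 card_Zq_gt0 muln_gt0 pair_const_gt0.
by move=> /subnK<-; elim: (j - i)%N => //= d IH; apply: leq_trans IH (H _).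
Qed.
End Params.

Section Main.
Variables (R : rcfType) (q n m k T : nat) (Msg : finType).
Local Notation C := (R[i]).
Local Notation V := {ffun 'I_n -> 'Z_q}.
Local Notation W := {ffun 'I_m * 'I_k -> 'Z_q}.
Local Notation pos := ('I_m * 'I_k.+1)%type.
Local Notation MM := {ffun pos -> 'I_n}.
Local Notation MT := {ffun 'I_T -> MM}.
Local Notation Q := (#|'Z_q| ^ k)%N.
Local Notation wgt := (@wgt R n).
Local Notation beta_seq := (beta_seq q k).
(** y bounds the length of messages, 2 D bounds n / y, 1 + 2 A is the growth rate of the thresholds,
    E y bounds all of them, and kap is the ratio of the geometric series bounding the fresh bias. *)
Variables (y A D : nat) (kap : R).
Hypotheses (n0 : (0 < n)%N) (m0 : (0 < m)%N) (mkn : (4 * (m * k.+1) <= n)%N).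
Local Notation E := ((1 + 2 * A) ^ T)%N.
Hypotheses (T0 : (0 < T)%N) (y0 : (0 < y)%N) (nD : (n <= 2 * D * y)%N).
Hypotheses (A5 : (5 <= A)%N) (hA : (8 * D * #|'Z_q| * beta_seq T <= 2 ^ A)%N).
Hypothesis hE : (2 * E * y <= m)%N.
Hypotheses (kap0 : 0 < kap) (kap1 : 2 * kap <= 1).
Hypothesis hkap : (4096 * Q ^ 2 * (beta_seq T ^ k.+1) ^ 2 * E * y)%:R <= kap ^+ 2 * n%:R.
Hypothesis hMsg : (#|Msg| <= 2 ^ (2 * y))%N.

(* Here j is the number of rounds still to be played, so the last threshold is 0. *)
Definition threshold j : nat := (((1 + 2 * A) ^ j).-1 * y)%N.

Lemma threshold_le j : (j <= T)%N -> (threshold j <= E * y)%N.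
Proof.
move=> jT; rewrite leq_mul2r; apply/orP; right; apply: leq_trans (leq_pred _) _.
by rewrite leq_pexp2l.
Qed.
Lemma thresholdS j : (threshold j + 2 * (A * (1 + 2 * A) ^ j * y) = threshold j.+1)%N.
Proof.
rewrite /threshold expnS; have : (0 < (1 + 2 * A) ^ j)%N by rewrite expn_gt0.
by case: ((1 + 2 * A) ^ j)%N => // z _ /=; rewrite !mulnDl; clear; nia.
Qed.

Lemma wgt_gt0 h : 0 < wgt h.
Proof. by rewrite sqrtr_gt0 divr_gt0 ?exprn_gt0 ?ltr0n ?fact_gt0. Qed.

(** Chosen so that level l contributes exactly kap^l to the sums required by [total_bias_step]. *)
Definition cap (b : nat) l : R := kap ^+ l / ((2 * b%:R ^+ k.+1) ^+ l * wgt (2 * l)).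

Lemma m_le_n : (m <= n)%N. Proof. by apply: leq_trans mkn; rewrite mulnCA leq_pmulr. Qed.

Lemma den_gt0 b l : (0 < b)%N -> 0 < (2 * b%:R ^+ k.+1) ^+ l * wgt (2 * l).
Proof.
by move=> b0; rewrite mulr_gt0 ?wgt_gt0 // exprn_gt0 // mulr_gt0 // exprn_gt0 // ltr0n.
Qed.

Lemma capE b l : (0 < b)%N -> cap b l * ((2 * b%:R ^+ k.+1) ^+ l * wgt (2 * l)) = kap ^+ l.
Proof. by move=> b0; rewrite mulfVK // gt_eqF // den_gt0. Qed.

(** The moment r is chosen with 2 y <= r l <= 2 E y: large enough for #|Msg| <= 2^(r l), small
    enough for r l <= m. What remains, after squaring, is [hkap]. *)
Lemma level_mass_le_cap (g : W -> Msg) v0 l b : (0 < b)%N -> (b <= beta_seq T)%N -> (l <= E * y)%N ->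
  level_mass R g l v0 <= cap b l.
Proof.
move=> b0 bT lE; rewrite ler_pdivlMr ?den_gt0 //.
have [->|l0] := posnP l.
  by rewrite !expr0 mul1r wgt0 mulr1 level_mass0.
set r := (2 * y %/ l).+1.
have E1 : (0 < E)%N by rewrite expn_gt0.
have rl1 : (2 * y <= r * l)%N by apply: ltnW; rewrite ltn_ceil.
have E2 : (2 <= E)%N.
  apply: (@leq_trans (1 + 2 * A)); first by clear -A5; lia.
  by rewrite -{1}(expn1 (1 + 2 * A)) leq_pexp2l.
have rl2 : (r * l <= 2 * (E * y))%N.
  rewrite /r mulSn addnC.
  apply: leq_trans (leq_add (leq_trunc_div _ _) lE) _.
  by rewrite mul2n -addnn [X in (_ <= X)%N]mul2n -addnn leq_add2r addnn -mul2n leq_mul2r E2 orbT.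
have rlm : (r * l <= m)%N by apply: leq_trans hE; rewrite -mulnA.
have M2 : (#|Msg| <= 2 ^ (r * l))%N.
  by apply: leq_trans hMsg _; rewrite leq_pexp2l.
have := level_mass_sqr_bound R g v0 l0 (ltn0Sn _) rlm M2; rewrite -/r => Hl.
have lev00 := level_mass_ge0 R g l v0.
set L := level_mass R g l v0 in Hl lev00 *.
have nR : 0 < n%:R :> R by rewrite ltr0n.
apply: ler_sqr_ge0; first by rewrite exprn_ge0 // ltW.
have EX (X : R) : (L * (X * wgt (2 * l))) ^+ 2 = L ^+ 2 * X ^+ 2 * (2 * l)`!%:R / n%:R ^+ (2 * l).
  by rewrite !exprMn sqr_wgt !mulrA.
rewrite EX.
have lR : 0 < (l ^ l)%:R :> R by rewrite ltr0n expn_gt0 l0.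
rewrite ler_pdivrMr ?exprn_gt0 // -(ler_pM2r lR).
apply: (@le_trans _ _ (((128 * Q ^ 2 * m * r) ^ l)%:R * ((2 * b%:R ^+ k.+1) ^+ l) ^+ 2 * (2 * l)`!%:R)).
  rewrite [leLHS](_ : _ = L ^+ 2 * (l ^ l)%:R * ((2 * b%:R ^+ k.+1) ^+ l) ^+ 2 * (2 * l)`!%:R); last first.
    by move: (_ ^+ l) => z; ring.
  by rewrite !ler_wpM2r ?ler0n ?exprn_ge0 ?mulr_ge0 ?exprn_ge0 ?ler0n.
apply: (@le_trans _ _
  (((128 * Q ^ 2 * m * r) ^ l)%:R * ((2 * (b ^ k.+1)) ^ l)%:R ^+ 2 * ((2 * l) ^ (2 * l))%:R)).
  have -> : ((2 * b ^ k.+1) ^ l)%:R = (2 * b%:R ^+ k.+1) ^+ l :> R by rewrite natrX natrM natrX.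
  rewrite ler_wpM2l //.
    by rewrite mulr_ge0 ?ler0n ?exprn_ge0 ?mulr_ge0 ?exprn_ge0 ?ler0n.
  by rewrite ler_nat; have := leq_bin_fact (2 * l) (2 * l); rewrite binn mul1n.
(* Here 2048 = 128 * 2^2 * 2^2. Of the two factors l in (2 l)^2, one joins r and the other matches
   l^l. Later r l <= 2 E y doubles the constant to 4096. *)
have -> : ((128 * Q ^ 2 * m * r) ^ l)%:R * ((2 * (b ^ k.+1)) ^ l)%:R ^+ 2 * ((2 * l) ^ (2 * l))%:R =
   ((2048 * Q ^ 2 * (b ^ k.+1) ^ 2 * m * (r * l)) ^ l)%:R * (l ^ l)%:R :> R.
  rewrite -natrX -!natrM; congr (_%:R).
  have e1 a : ((a ^ l) ^ 2 = (a ^ 2) ^ l)%N by rewrite -!expnM mulnC.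
  rewrite e1 (expnM (2 * l)) -!expnMn; congr (_ ^ _)%N.
  by move: (Q) (b ^ k.+1)%N => x z; ring.
rewrite ler_wpM2r ?ler0n //.
have -> : (kap ^+ l) ^+ 2 * n%:R ^+ (2 * l) = (kap ^+ 2 * n%:R * n%:R) ^+ l.
  by rewrite -exprM (mulnC l 2%N) !exprM -exprMn; congr (_ ^+ l); ring.
rewrite natrX lerXn2r ?nnegrE ?ler0n //.
  by rewrite !mulr_ge0 // ?sqr_ge0 // ltW.
apply: (@le_trans _ _ ((4096 * Q ^ 2 * (beta_seq T ^ k.+1) ^ 2 * E * y)%:R * n%:R));
  last by rewrite ler_wpM2r ?ler0n.
rewrite -natrM ler_nat.
have -> : (4096 * Q ^ 2 * (beta_seq T ^ k.+1) ^ 2 * E * y * n =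
   2048 * Q ^ 2 * (beta_seq T ^ k.+1) ^ 2 * n * (2 * (E * y)))%N.
  by move: (Q) (beta_seq T ^ k.+1)%N E => x z e; ring.
apply: leq_mul => //; apply: leq_mul; last exact: m_le_n.
by apply: leq_mul => //; rewrite !leq_expl.
Qed.

(** A nonzero threshold h is at least y, so n / h <= 2 D and the bound (4 n / h)^h on the binomial
    is exponential in h. *)
Lemma card_threshold j : (j <= T)%N ->
  (#|[set s : V | (wt s <= threshold j)%N]| <= (8 * D * #|'Z_q|) ^ threshold j)%N.
Proof.
move=> jT; have En : (threshold j <= n)%N.
  by apply: leq_trans (threshold_le jT) _; apply: leq_trans m_le_n;
    apply: leq_trans hE; rewrite -mulnA leq_pmull.
have := @card_wt_le q 'I_n (threshold j); rewrite (card_ord n) => /(_ En) H.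
apply: leq_trans H _; rewrite expnMn leq_mul2r; apply/orP; right.
have [->|h0] := posnP (threshold j); first by rewrite bin0.
have hp : (0 < threshold j ^ threshold j)%N by rewrite expn_gt0 h0.
rewrite -(leq_pmul2r hp); apply: leq_trans (leq_bin_expn _ _) _.
rewrite -expnMn leq_expl //.
apply: (@leq_trans (4 * (2 * D * y))); first by rewrite leq_mul2l nD.
have : (y <= threshold j)%N.
  move: h0; rewrite /threshold muln_gt0 => /andP[c0 _]; by rewrite leq_pmull.
by clear; nia.
Qed.

(** In powers of 2: the messages cost 4 y, the frequencies with their weights A times the threshold
    by [hA], and the target y. The denominator exceeds the second by exactly A y, and A >= 5. *)
Lemma high_part_small j : (j < T)%N ->
  ((#|Msg| ^ 2 * #|[set s : V | (wt s <= threshold j)%N]|)%:R * (beta_seq j)%:R ^+ threshold j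
     / 2 ^+ (A * (1 + 2 * A) ^ j * y) <= (2 ^+ y)^-1 :> R).
Proof.
move=> jT; have jT' := ltnW jT.
rewrite ler_pdivrMr ?exprn_gt0 // [leRHS]mulrC ler_pdivlMr ?exprn_gt0 //.
rewrite -!natrX -!natrM ler_nat.
apply: (@leq_trans ((2 ^ (2 * y)) ^ 2 * (8 * D * #|'Z_q|) ^ threshold j * beta_seq T ^ threshold j * 2 ^ y)).
  apply: leq_mul => //; apply: leq_mul; last by rewrite leq_expl // beta_seq_mono.
  by apply: leq_mul; [rewrite leq_expl | exact: card_threshold].
rewrite -(mulnA (_ ^ 2)%N) -expnMn.
apply: (@leq_trans ((2 ^ (2 * y)) ^ 2 * (2 ^ A) ^ threshold j * 2 ^ y)).
  by rewrite leq_mul2r leq_mul2l leq_expl ?orbT.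
rewrite -!expnM -!expnD leq_pexp2l //.
rewrite /threshold; have : (0 < (1 + 2 * A) ^ j)%N by rewrite expn_gt0.
by case: ((1 + 2 * A) ^ j)%N => // z _ /=; clear -A5; nia.
Qed.

Variables (step : nat -> MM -> W -> Msg -> Msg) (a0 : Msg).

Lemma protocol_bound (acc : Msg) :
  `| (#|{: V}|%:R)^-1 * \sum_(Ms : MT | valid Ms) \sum_x
        (state step a0 (mext n0 Ms) (fun i => observe (mext n0 Ms i) x) T == acc)%:R -
     (#|{: {ffun 'I_T -> W}}|%:R)^-1 * \sum_(Ms : MT | valid Ms) \sum_(ws : {ffun 'I_T -> W})
        (state step a0 (mext n0 Ms) (wext ws) T == acc)%:R | <=
  2 ^+ T * (#|@valid n m k T|%:R * (2 * kap + (2 ^+ y)^-1)) :> R.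
Proof.
apply: le_trans (@advantage_bound R q n m k T Msg n0 step a0 (beta_seq 0)%:R acc) _.
have := @total_bias_iter R q n m k T Msg n0 step a0
  (fun t => threshold (T - t)) (fun t => (beta_seq (T - t))%:R)
  (2 * kap + (2 ^+ y)^-1).
rewrite subnn /threshold expn0 mul0n; apply.
  by rewrite addr_ge0 ?mulr_ge0 ?invr_ge0 ?exprn_ge0 // ltW.
move=> t; set j := (T - t.+1)%N.
have jT : (j < T)%N by rewrite /j ltn_subrL T0.
have jE : (T - t = j.+1)%N by rewrite /j subnSK.
rewrite jE.
have bE : (beta_seq j.+1)%:R = beta' q k (beta_seq j)%:R :> R.
  by rewrite /= /beta' natrM natrX natrM natrM.
have E1 : (0 < E)%N by rewrite expn_gt0.
have tE : (threshold j.+1 <= E * y)%N by apply: threshold_le.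
have tE' : (threshold j <= E * y)%N by apply: threshold_le; apply: ltnW.
have Em : (2 * (E * y) <= m)%N by rewrite mulnA.
have sumE : \sum_(1 <= l < (threshold j).+1) cap (beta_seq j) l *
    ((2 * (beta_seq j)%:R ^+ k.+1) ^+ l * wgt (2 * l)) <= 2 * kap.
  under eq_bigr do rewrite capE ?beta_seq_gt0 //.
  by apply: sum_geom => //; apply: ltW.
have := @total_bias_step R q n m k T Msg n0 m0 mkn step a0 t (threshold j.+1) (threshold j)
  (A * (1 + 2 * A) ^ j * y) (beta_seq j)%:R (cap (beta_seq j)) (2 * kap).
rewrite -bE => PS; apply: le_trans (PS _ _ _ _ _ _ _ _) _.
- by rewrite ler1n beta_seq_gt0.
- by apply: leq_trans m_le_n; apply: leq_trans Em; rewrite leq_mul2l.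
- apply: leq_trans Em; rewrite -divn2; apply: leq_trans (leq_div _ _) _.
  by apply: leq_trans tE _; rewrite leq_pmull.
- move=> g v0 l lj; apply: level_mass_le_cap; rewrite ?beta_seq_gt0 ?beta_seq_mono ?(ltnW jT) //.
  exact: leq_trans tE'.
- rewrite -(big_mkord predT (fun l => cap (beta_seq j) l *
    ((2 * (beta_seq j)%:R ^+ k.+1) ^+ l * wgt (2 * l)))).
  rewrite big_ltn // capE ?beta_seq_gt0 // expr0.
  by rewrite -[2]/(1 + 1) lerD2l; apply: le_trans sumE _.
- exact: sumE.
- by rewrite mulr_ge0 // ltW.
- by rewrite thresholdS.
rewrite lerD2l ler_wpM2l ?ler0n // lerD2l.
exact: high_part_small.
Qed.
End Main.

(** * Protocols as message functions with a finite alphabet *)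

Lemma unif_probE (R : realType) (X : finType) (S E : pred X) :
  unif_prob R S E = #|S|%:R^-1 * \sum_(x | S x) (E x)%:R.
Proof.
rewrite /unif_prob mulrC; congr (_ * _).
rewrite -sum1_card natr_sum.
by rewrite big_mkcondr /=; apply: eq_bigr => x _; rewrite unfold_in; case: (E x).
Qed.

Lemma sum_pair_snd (R : realType) (A B : finType) (S : pred B) (F : A * B -> R) :
  \sum_(p | S p.2) F p = \sum_(b | S b) \sum_a F (a, b).
Proof. by rewrite exchange_big pair_big /=; apply: eq_big => -[]. Qed.

Lemma sum_pair_fst (R : realType) (A B : finType) (S : pred B) (F : B * A -> R) :
  \sum_(p | S p.1) F p = \sum_(b | S b) \sum_a F (b, a).
Proof. by rewrite pair_big /=; apply: eq_big => -[a b] //=; rewrite ?andbT. Qed.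

Lemma unif_prob_snd (R : realType) (A B : finType) (S : pred B) (E : pred (A * B)) :
  unif_prob R (fun p : A * B => S p.2) E =
  #|S|%:R^-1 * (#|A|%:R^-1 * \sum_(b | S b) \sum_a (E (a, b))%:R).
Proof.
rewrite unif_probE sum_pair_snd mulrA -invfM; congr (_^-1 * _).
rewrite -[#|fun p : A * B => S p.2|]sum1_card natr_sum sum_pair_snd.
by under eq_bigr do rewrite sumr_const; rewrite sumr_const mulr_natl.
Qed.

Lemma unif_prob_fst (R : realType) (A B : finType) (S : pred B) (E : pred (B * A)) :
  unif_prob R (fun p : B * A => S p.1) E =
  #|S|%:R^-1 * (#|A|%:R^-1 * \sum_(b | S b) \sum_a (E (b, a))%:R).
Proof.
rewrite unif_probE sum_pair_fst mulrA -invfM; congr (_^-1 * _).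
rewrite -[#|fun p : B * A => S p.1|]sum1_card natr_sum sum_pair_fst.
by under eq_bigr do rewrite sumr_const; rewrite sumr_const mulr_natl.
Qed.

Section Link.
Variables (R : realType) (q n m k T : nat).
Local Notation V := {ffun 'I_n -> 'Z_q}.
Local Notation W := {ffun 'I_m * 'I_k -> 'Z_q}.
Local Notation pos := ('I_m * 'I_k.+1)%type.
Local Notation MM := {ffun pos -> 'I_n}.
Local Notation MT := {ffun 'I_T -> MM}.
Local Notation WT := {ffun 'I_T -> W}.

Definition col_of (w : W) : vec_t q k.+1 m := \col_r w (@row_pair k.+1 m r).
Definition of_col (v : vec_t q k.+1 m) : W :=
  [ffun p => v (cast_ord (@mxvec_cast m k) (enum_rank p)) 0].
Lemma col_ofK : cancel col_of of_col.
Proof.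
move=> w; apply/ffunP => p; rewrite ffunE mxE /row_pair.
by rewrite cast_ordK enum_rankK.
Qed.
Lemma of_colK : cancel of_col col_of.
Proof.
move=> v; apply/matrixP => r j; rewrite mxE ffunE ord1 /row_pair enum_valK.
by rewrite cast_ordKV.
Qed.

Definition vec_of (x : 'cV['Z_q]_n) : V := [ffun j => x j 0].
Definition of_vec (x : V) : 'cV['Z_q]_n := \col_j x j.
Lemma vec_ofK : cancel vec_of of_vec.
Proof. by move=> x; apply/matrixP => i j; rewrite mxE ffunE ord1. Qed.
Lemma of_vecK : cancel of_vec vec_of.
Proof. by move=> x; apply/ffunP => i; rewrite ffunE mxE. Qed.

Lemma is_centerE (M : hypermatching k.+1 n m) i j : is_center M i j = (M (i, ord_max) == j).
Proof.
apply/existsP/idP => [[c /andP[/eqP ck]]|Mj]; last by exists ord_max; rewrite Mj /= eqxx.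
by have -> : c = ord_max by apply: val_inj.
Qed.

Lemma folded_enc_observe (M : hypermatching k.+1 n m) (x : V) :
  folded_enc q M *m of_vec x = col_of (observe M x).
Proof.
apply/matrixP => r j; rewrite !mxE ffunE.
under eq_bigr => i _ do rewrite !mxE /= is_centerE mulrBl.
rewrite sumrB; congr (_ - _).
  rewrite (bigD1 (M ((row_pair r).1, lift ord_max (row_pair r).2))) //= big1 => [|i].
    rewrite addr0; set w := widen_ord _ _.
    have -> : w = lift ord_max (row_pair r).2.
      by apply: val_inj; rewrite /= /bump leqNgt ltn_ord.
    by rewrite eqxx mul1r.
  set w := widen_ord _ _; have -> : w = lift ord_max (row_pair r).2.
    by apply: val_inj; rewrite /= /bump leqNgt ltn_ord.
  by rewrite eq_sym => /negPf->; rewrite mul0r.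
rewrite (bigD1 (M ((row_pair r).1, ord_max))) //= eqxx mul1r big1 ?addr0 // => i.
by rewrite eq_sym => /negPf->; rewrite mul0r.
Qed.

Variables (P : protocol q k.+1 n m) (y : nat).
Hypotheses (n0 : (0 < n)%N) (T0 : (0 < T)%N) (y0 : (0 < y)%N).
Hypothesis short : forall (Ms : MT) (ws : {ffun 'I_T -> vec_t q k.+1 m}) t,
  valid_profile Ms -> (t < T.-1)%N ->
  (size (received P (run_A q Ms) (nth_input 0%R ws) t.+1) <= y)%N.

Local Notation Msg := ({bseq y of bool}).
(** The decision of the last player is encoded as a one-bit message, so that all T rounds have the
    same form. Overlong messages become a default value, which [short] excludes on valid
    profiles. *)
Definition msg_step (t : nat) (M : MM) (w : W) (a : Msg) : Msg :=
  if t == T.-1 then insub_bseq y [:: decide P (folded_enc q M) (col_of w) a]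
  else insub_bseq y (send P t (folded_enc q M) (col_of w) a).
Definition msg0 : Msg := insub_bseq y [::].
Definition accept : Msg := insub_bseq y [:: true].

Lemma insub_bseqK (s : seq bool) : (size s <= y)%N -> insub_bseq y s = s :> seq bool.
Proof. by move=> sy; rewrite /insub_bseq val_insubd sy. Qed.

Lemma eq_received A A' (w w' : nat -> vec_t q k.+1 m) t : (forall i, (i < t)%N -> A i = A' i) ->
  (forall i, (i < t)%N -> w i = w' i) -> received P A w t = received P A' w' t.
Proof.
elim: t => //= t IH AA ww; rewrite AA // ww // IH // => i it; [apply: AA | apply: ww]; exact: ltnW.
Qed.

Lemma state_received (Ms : MT) (ws : WT) t : valid_profile Ms -> (t <= T.-1)%N ->
  state msg_step msg0 (mext n0 Ms) (wext ws) t =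
  received P (run_A q Ms) (nth_input 0 (fun i => col_of (ws i))) t :> seq bool.
Proof.
move=> vMs; elim: t => [|t IH] tT; first by rewrite insub_bseqK.
have tT' : (t < T)%N by apply: leq_trans tT (leq_pred T).
have sz := @short Ms [ffun i => col_of (ws i)] t vMs tT.
have E : nth_input 0 [ffun i => col_of (ws i)] =1 nth_input 0 (fun i : 'I_T => col_of (ws i)).
  by move=> i; rewrite /nth_input; case: insubP => // j; rewrite ffunE.
rewrite (@eq_received _ (run_A q Ms) _ (nth_input 0 (fun i => col_of (ws i)))) // in sz.
rewrite [LHS]/= {1}/msg_step (ltn_eqF tT) /= IH ?(ltnW tT) //.
have -> : run_A q Ms t = folded_enc q (mext n0 Ms t).
  by rewrite -[t]/(val (Ordinal tT')) /run_A /mext !nth_input_ord.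
have Ew : nth_input 0 (fun i : 'I_T => col_of (ws i)) t = col_of (wext ws t).
  by rewrite -[t]/(val (Ordinal tT')) /wext !nth_input_ord.
rewrite Ew insub_bseqK //.
move: sz; rewrite /= Ew -/(run_A _ _).
have -> : run_A q Ms t = folded_enc q (mext n0 Ms t).
  by rewrite -[t]/(val (Ordinal tT')) /run_A /mext !nth_input_ord.
by [].
Qed.

Lemma state_output (Ms : MT) (ws : WT) : valid_profile Ms ->
  (state msg_step msg0 (mext n0 Ms) (wext ws) T == accept) =
  output P Ms (fun i => col_of (ws i)).
Proof.
move=> vMs; have tT' : (T.-1 < T)%N by rewrite prednK.
have stS A w t : (0 < t)%N -> state msg_step msg0 A w t =
    msg_step t.-1 (A t.-1) (w t.-1) (state msg_step msg0 A w t.-1) by case: t.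
rewrite stS // {1}/msg_step eqxx /output.
rewrite -(state_received ws vMs (leqnn _)).
have -> : run_A q Ms T.-1 = folded_enc q (mext n0 Ms T.-1).
  by rewrite -[T.-1]/(val (Ordinal tT')) /run_A /mext !nth_input_ord.
have -> : nth_input 0 (fun i : 'I_T => col_of (ws i)) T.-1 = col_of (wext ws T.-1).
  by rewrite -[T.-1]/(val (Ordinal tT')) /wext !nth_input_ord.
case: (decide _ _ _ _); first by rewrite eqxx.
by apply/negbTE/eqP => /(congr1 val) /=; rewrite !insub_bseqK.
Qed.

Lemma valid_profileE (Ms : MT) : valid_profile Ms = valid Ms.
Proof. by apply: eq_forallb => t; rewrite inE. Qed.

Lemma state_observe (Ms : MT) (x : V) t : (t <= T)%N ->
  state msg_step msg0 (mext n0 Ms) (fun i => observe (mext n0 Ms i) x) t =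
  state msg_step msg0 (mext n0 Ms) (wext [ffun i => observe (Ms i) x]) t.
Proof.
move=> tT; apply: eq_state => // t' tt'.
have tT' : (t' < T)%N by apply: leq_trans tT.
by rewrite -[t']/(val (Ordinal tT')) /wext /mext !nth_input_ord ffunE.
Qed.

Lemma eq_output (Ms : MT) (ws ws' : 'I_T -> vec_t q k.+1 m) : ws =1 ws' ->
  output P Ms ws = output P Ms ws'.
Proof.
move=> ww; have E t : nth_input 0 ws t = nth_input 0 ws' t.
  by rewrite /nth_input; case: insubP.
by rewrite /output E (@eq_received _ (run_A q Ms) _ (nth_input 0 ws')).
Qed.

Lemma prob_yesE : prob_yes T R P =
  #|@valid n m k T|%:R^-1 * ((#|{: V}|%:R)^-1 * \sum_(Ms : MT | valid Ms) \sum_x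
        (state msg_step msg0 (mext n0 Ms) (fun i => observe (mext n0 Ms i) x) T == accept)%:R).
Proof.
rewrite /prob_yes unif_prob_snd.
have cS : #|fun Ms : MT => valid_profile Ms| = #|@valid n m k T|.
  by apply: eq_card => Ms; rewrite -[LHS]/(valid_profile Ms) -[RHS]/(valid Ms) valid_profileE.
rewrite cS; congr (_ * (_ * _)).
  by rewrite card_mx muln1 card_ffun !card_ord.
apply: eq_big => [Ms|Ms vMs]; first exact: valid_profileE.
rewrite (reindex of_vec) /=; last by exists vec_of => x _; rewrite ?of_vecK ?vec_ofK.
apply: eq_bigr => x _; rewrite state_observe // state_output //.
congr (nat_of_bool _)%:R; apply: eq_output => t; by rewrite ffunE folded_enc_observe.
Qed.

Lemma prob_noE : prob_no T R P =
  #|@valid n m k T|%:R^-1 * ((#|{: WT}|%:R)^-1 * \sum_(Ms : MT | valid Ms) \sum_(ws : WT)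
        (state msg_step msg0 (mext n0 Ms) (wext ws) T == accept)%:R).
Proof.
rewrite /prob_no unif_prob_fst.
have cS : #|fun Ms : MT => valid_profile Ms| = #|@valid n m k T|.
  by apply: eq_card => Ms; rewrite -[LHS]/(valid_profile Ms) -[RHS]/(valid Ms) valid_profileE.
rewrite cS; congr (_ * (_ * _)).
  by rewrite !card_ffun card_mx muln1 card_prod !card_ord.
apply: eq_big => [Ms|Ms vMs]; first exact: valid_profileE.
rewrite (reindex (fun ws : WT => [ffun t => col_of (ws t)])) /=; last first.
  exists (fun ws => [ffun t => of_col (ws t)]) => ws _; apply/ffunP => t; rewrite !ffunE.
    exact: col_ofK.
  exact: of_colK.
apply: eq_bigr => ws _; rewrite state_output //.
by congr (nat_of_bool _)%:R; apply: eq_output => t; rewrite ffunE.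
Qed.

Variables (A D : nat) (kap : R).
Hypotheses (m0 : (0 < m)%N) (mkn : (4 * (m * k.+1) <= n)%N).
Hypotheses (nD : (n <= 2 * D * y)%N).
Hypotheses (A5 : (5 <= A)%N) (hA : (8 * D * #|'Z_q| * beta_seq q k T <= 2 ^ A)%N).
Hypothesis hE : (2 * (1 + 2 * A) ^ T * y <= m)%N.
Hypotheses (kap0 : 0 < kap) (kap1 : 2 * kap <= 1).
Hypothesis hkap : (4096 * (#|'Z_q| ^ k) ^ 2 * (beta_seq q k T ^ k.+1) ^ 2 * (1 + 2 * A) ^ T * y)%:R
  <= kap ^+ 2 * n%:R.

Lemma advantage_le : advantage T R P <= 2 ^+ T * (2 * kap + (2 ^+ y)^-1).
Proof.
(* There are fewer than 2^(y + 1) bit strings of length at most y, and y + 1 <= 2 y. *)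
have hMsg : (#|{: Msg}| <= 2 ^ (2 * y))%N.
  have H h : (\sum_(i < h) 2 ^ i < 2 ^ h)%N.
    elim: h => [|h IH]; first by rewrite big_ord0.
    by rewrite big_ord_recr /= expnS mul2n -addnn -addSn leq_add.
  rewrite card_bseq card_bool; apply: leq_trans (ltnW (H _)) _.
  by rewrite leq_pexp2l // mul2n -addnn -addn1 leq_add2l.
rewrite /advantage prob_yesE prob_noE -mulrBr normrM ger0_norm ?invr_ge0 ?ler0n //.
have B := protocol_bound n0 m0 mkn T0 nD A5 hA hE kap0 kap1 hkap hMsg msg_step msg0 accept.
apply: le_trans (ler_wpM2l _ B) _; first by rewrite invr_ge0 ler0n.
rewrite mulrCA ler_wpM2l ?exprn_ge0 // mulrA.
have e0 : 0 <= 2 * kap + (2 ^+ y)^-1 by rewrite addr_ge0 ?invr_ge0 ?exprn_ge0 ?mulr_ge0 // ltW.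
have [->|v0] := eqVneq (#|@valid n m k T|%:R : R) 0; first by rewrite mulr0 mul0r.
by rewrite mulVf // mul1r.
Qed.
End Link.

(** * Numerical parameters and conclusion *)

Lemma leq_sqr_exp2 i : (4 <= i)%N -> (i * i <= 2 ^ i)%N.
Proof.
move=> /subnK<-; elim: (i - 4)%N => //= d IH.
rewrite addSn expnS; apply: (@leq_trans (2 * ((d + 4) * (d + 4)))); last by rewrite leq_mul2l.
by clear; nia.
Qed.

Lemma leq_exp2 x : (x <= 2 ^ x)%N.
Proof. exact: ltnW (ltn_expl _ _). Qed.

(** Resolves a circular choice: D = 2^lam must dominate c E, while E is a power of 1 + 2 A with A =
    lam + s. With lam = 2^i it suffices that c + (i + 2) T <= i^2 <= 2^i. *)
Lemma exp_beats_poly (c s T : nat) :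
  exists lam, (c * (1 + 2 * (lam + s)) ^ T <= 2 ^ lam)%N.
Proof.
pose i := (c + 3 * T + s + 4)%N; exists (2 ^ i)%N.
have i4 : (4 <= i)%N by rewrite leq_addl.
have h1 : (1 + 2 * (2 ^ i + s) <= 2 ^ (i + 2))%N.
  have si : (s + 2 <= 2 ^ i)%N by apply: leq_trans (leq_exp2 i); rewrite /i; clear; lia.
  by rewrite expnD; clear -si; lia.
apply: (@leq_trans (2 ^ c * (2 ^ (i + 2)) ^ T)).
  by apply: leq_mul; [exact: leq_exp2 | exact: leq_expl].
rewrite -expnM -expnD leq_pexp2l //; apply: leq_trans (leq_sqr_exp2 i4).
by rewrite /i; clear; nia.
Qed.

Theorem theorem3p4 (R : realType) (q k : nat) :
  (2 <= q)%N -> (2 <= k)%N ->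
  exists alpha0 : R, 0 < alpha0 /\ alpha0 < (k%:R)^-1 /\
  forall alpha : R, 0 < alpha -> alpha <= alpha0 ->
  forall T : nat, (0 < T)%N ->
  forall delta : R, 0 < delta -> delta < 1 ->
  exists tau : R, 0 < tau /\ tau < 1 /\
  exists n0 : nat, forall n m : nat, (n0 <= n)%N ->
    m%:R = alpha * n%:R ->
    forall P : protocol q k n m,
      delta < advantage T R P -> some_long_message T P tau.
Proof.
move=> _ k2; case: k k2 => // k _.
have K0 : 0 < k.+1%:R :> R by rewrite ltr0n.
(* This bound on alpha gives [mkn], the hypothesis behind [cover_prob]. *)
exists (4 * k.+1%:R)^-1; split; first by rewrite invr_gt0 mulr_gt0.
split; first by rewrite ltf_pV2 ?posrE ?mulr_gt0 // ltr_pMl // ltr1n.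
move=> alpha al0 alK T T0 delta d0 d1.
(* The fresh bias of all rounds, 2^T * 2 kap, receives half of delta. *)
pose kap : R := delta / 2 ^+ T.+2.
have kap0 : 0 < kap by rewrite divr_gt0 ?exprn_gt0.
have kapT : 2 ^+ T * (2 * kap) = delta / 2.
  by rewrite /kap !exprS; field; rewrite expf_neq0 ?pnatr_eq0.
have kap1 : 2 * kap <= 1.
  have : 1 <= 2 ^+ T :> R by rewrite exprn_ege1 // ler1n.
  move=> /(ler_peMl (ltW (mulr_gt0 (ltr0Sn R 1) kap0))); rewrite kapT; lra.
pose B := (4096 * (#|'Z_q| ^ k) ^ 2 * (beta_seq q k T ^ k.+1) ^ 2)%N.
(* Large enough that c E y <= n implies both [hE] and [hkap]. *)
pose c := (Num.truncn (2 / alpha) + Num.truncn (B%:R / kap ^+ 2)).+2.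
have ca : 2 <= alpha * c%:R.
  rewrite -ler_pdivrMl // mulrC; apply: le_trans (ltW (truncnS_gt _)) _.
  by rewrite ler_nat /c ltnS leqW ?leq_addr.
have cB : B%:R <= kap ^+ 2 * c%:R.
  rewrite -ler_pdivrMl ?exprn_gt0 // mulrC; apply: le_trans (ltW (truncnS_gt _)) _.
  by rewrite ler_nat /c ltnS leqW ?leq_addl.
(* Ensures A >= 5, and 2^A = D * 2^s with 2^s >= s absorbing the constants of [hA]. *)
pose s := (8 * #|'Z_q| * beta_seq q k T + 5)%N.
have [lam hlam] := exp_beats_poly c s T.
pose D := (2 ^ lam)%N; pose A := (lam + s)%N.
have D0 : (0 < D)%N by rewrite expn_gt0.
have hA : (8 * D * #|'Z_q| * beta_seq q k T <= 2 ^ A)%N.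
  rewrite /A expnD mulnAC -!mulnA mulnCA leq_mul2l; apply/orP; right.
  apply: leq_trans (leq_exp2 s); rewrite /s mulnA; clear; lia.
(* From this y on, the high-frequency error 2^T / 2^y is at most the other half of delta. *)
pose y0 := (Num.truncn (2 ^+ T.+1 / delta)).+1.
(* With y the quotient of n by D, n <= 2 D y, so a message of fewer than tau n bits has at most y
   bits. *)
exists (2 * D%:R)^-1; split; first by rewrite invr_gt0 mulr_gt0 ?ltr0n.
split.
  rewrite invf_lt1 ?mulr_gt0 ?ltr0n // -natrM ltr1n.
  by rewrite (@leq_trans (2 * 1)) // leq_mul2l.
exists (D * y0)%N => n m nn0 mE P adv.
pose y := (n %/ D)%N.
have yy : (y0 <= y)%N by rewrite leq_divRL // mulnC.
have y_gt0 : (0 < y)%N by apply: leq_trans yy.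
have Dy : (D * y <= n)%N by rewrite mulnC leq_trunc_div.
have nD : (n <= 2 * D * y)%N.
  have : (n < y.+1 * D)%N by rewrite ltn_ceil.
  by move: y_gt0; clear; nia.
have n0 : (0 < n)%N by apply: leq_trans Dy; rewrite muln_gt0 D0.
have nR : 0 < n%:R :> R by rewrite ltr0n.
have m0 : (0 < m)%N by rewrite -(ltr0n R) mE mulr_gt0.
have mkn : (4 * (m * k.+1) <= n)%N.
  rewrite -(ler_nat R) !natrM mE.
  have -> : 4 * (alpha * n%:R * k.+1%:R) = n%:R * (alpha * (4 * k.+1%:R)) by ring.
  by rewrite ler_piMr ?ler0n // -ler_pdivlMr ?mulr_gt0 // div1r.
have DyR : D%:R * y%:R <= n%:R :> R by rewrite -natrM ler_nat.
pose E := ((1 + 2 * A) ^ T)%N.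
have cE : c%:R * E%:R <= D%:R :> R by rewrite -natrM ler_nat.
have E0 : 0 <= E%:R :> R by rewrite ler0n.
have yR : 0 <= y%:R :> R by rewrite ler0n.
have hE : (2 * E * y <= m)%N.
  rewrite -(ler_nat R) !natrM mE.
  apply: (@le_trans _ _ (alpha * c%:R * E%:R * y%:R)); first by rewrite !ler_wpM2r.
  rewrite -!mulrA ler_pM2l //; apply: le_trans DyR.
  by rewrite mulrA ler_wpM2r.
have hkap : (B * E * y)%:R <= kap ^+ 2 * n%:R.
  rewrite natrM natrM; apply: (@le_trans _ _ (kap ^+ 2 * c%:R * E%:R * y%:R)); first by rewrite !ler_wpM2r.
  rewrite -(mulrA (kap ^+ 2)) -(mulrA (kap ^+ 2)) ler_pM2l ?exprn_gt0 //.
  by apply: le_trans DyR; rewrite ler_wpM2r.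
(* The conclusion as a Boolean over finite types, so that it can be decided and its negation gives
   [short]. *)
pose long := [exists Ms : {ffun 'I_T -> hypermatching k.+1 n m},
  [exists ws : {ffun 'I_T -> vec_t q k.+1 m}, [exists t : 'I_T.-1, valid_profile Ms &&
    ((2 * D%:R)^-1 * n%:R <= (size (received P (run_A q Ms) (nth_input 0 ws) t.+1))%:R :> R)]]].
have [/existsP[Ms /existsP[ws /existsP[t /andP[vMs le]]]]|no] := boolP long.
  by exists Ms, ws, t; split.
have short (Ms : {ffun 'I_T -> hypermatching k.+1 n m}) (ws : {ffun 'I_T -> vec_t q k.+1 m}) t :
    valid_profile Ms -> (t < T.-1)%N ->
    (size (received P (run_A q Ms) (nth_input 0%R ws) t.+1) <= y)%N.
  move=> vMs tT; move: no; rewrite negb_exists => /forallP/(_ Ms).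
  rewrite negb_exists => /forallP/(_ ws); rewrite negb_exists => /forallP/(_ (Ordinal tT)).
  rewrite vMs /= -ltNge mulrC ltr_pdivlMr ?mulr_gt0 ?ltr0n // -!natrM ltr_nat => sz.
  have := leq_trans sz nD; rewrite mulnC ltn_pmul2l ?muln_gt0 // => /ltnW; exact.
have A5 : (5 <= A)%N by rewrite /A /s; clear; lia.
have := advantage_le n0 T0 y_gt0 short m0 mkn nD A5 hA hE kap0 kap1 hkap.
suff le : 2 ^+ T * (2 * kap + (2 ^+ y)^-1) <= delta.
  by move=> /le_trans/(_ le); rewrite leNgt adv.
rewrite mulrDr kapT.
suff : 2 ^+ T / 2 ^+ y <= delta / 2 by lra.
rewrite ler_pdivrMr ?exprn_gt0 // mulrAC ler_pdivlMr // mulrC -exprS.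
rewrite mulrC -ler_pdivrMr //.
apply: le_trans (ltW (truncnS_gt _)) _; rewrite -natrX ler_nat.
exact: leq_trans yy (leq_exp2 _).
Qed.
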